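(* Let $R$ be a noetherian domain and $X=\operatorname{Spec} R$. Then the ring of global sections of $X$ in the finite topology is the compatible normalization of $R$ inside the perfect closure $Q(R)^{\infty}$ of the quotient field of $R$, i.e. $\Gamma(X_{\mathrm{fin}},\mathcal O_{\mathrm{fin}})=R^{\mathrm{comp}}$.
   Context: A scheme morphism is called a finite cover if it is finite and surjective. Finite topology $X_{\mathrm{fin}}$ on a scheme $X$: the category consists of schemes over $X$ whose structural morphisms to $X$ are finite covers, with all finite $X$-morphisms as morphisms; the coverings are the single morphisms which are finite covers. $\mathcal O_{\mathrm{fin}}$ is the sheafification of the presheaf $\operatorname{Spec} S\mapsto S$. For a ring homomorphism $R\to L$, the compatible integral closure of $R$ in $L$ is the set of all $f\in L$ such that there exists a finite $R$-algebra $T\subseteq L$ with $f\in T$ and such that $f\otimes1-1\otimes f\in T\otimes_RT$ is nilpotent. For a domain $R$ with quotient field $Q(R)$, the compatible normalization $R^{\mathrm{comp}}$ is the compatible integral closure of $R$ in $L=Q(R)^\infty$, the perfect closure of $Q(R)$ (equal to $Q(R)$ in characteristic $0$, and $\varinjlim_e{}^eQ(R)$ under Frobenius in positive characteristic). *)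

(* Defs.v *)
From HB Require Import structures.
From mathcomp Require Import all_boot all_order all_algebra.
From mathcomp Require Import generic_quotient ring_quotient fraction ring.

Set Implicit Arguments.
Unset Strict Implicit.
Unset Printing Implicit Defensive.

Import GRing.Theory.
Local Open Scope ring_scope.
Local Open Scope quotient_scope.

(* Library ideals are Boolean predicates; under the classical axioms these are
   all the subsets of the ring. They are also proper by definition, which
   costs nothing below: the unit ideal is always finitely generated. *)
Definition noetherian (R : comNzRingType) : Prop :=
  forall I : idealr R, exists (n : nat) (g : 'I_n -> R),
    forall x, (x \in I) <-> (exists c : 'I_n -> R, x = \sum_i c i * g i).

Definition nilpotent (R : pzRingType) (x : R) : Prop := exists n, x ^+ n = 0.

Definition finite_hom (R S : comNzRingType) (u : {rmorphism R -> S}) : Prop :=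
  exists (n : nat) (g : 'I_n -> S),
    forall x, exists c : 'I_n -> R, x = \sum_i u (c i) * g i.

(* Surjectivity of Spec S -> Spec R. *)
Definition spec_surjective (R S : comNzRingType) (u : {rmorphism R -> S}) :
    Prop :=
  forall p : prime_idealr R, exists q : prime_idealr S,
    forall x, (x \in p) = (u x \in q).

(* The ring homomorphism u is dual to a finite cover Spec S -> Spec R. *)
Definition finite_cover (R S : comNzRingType) (u : {rmorphism R -> S}) : Prop :=
  finite_hom u /\ spec_surjective u.

(* A finite morphism is affine, so an object of X_fin, for X = Spec R, is
   Spec S -> X for an R-algebra S, and S is not the zero ring because Spec S
   surjects onto the nonempty X. The site is written on the ring side: arrows
   point in the direction opposite to the morphisms of schemes, and presheaves
   are covariant in the rings. *)

Record fin_obj (R : comNzRingType) := FinObj {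
  fin_ring :> comNzRingType;
  fin_str : {rmorphism R -> fin_ring};
  fin_objP : finite_cover fin_str
}.

(* A finite X-morphism Spec T -> Spec S. *)
Record fin_mor (R : comNzRingType) (S T : fin_obj R) := FinMor {
  fin_hom :> {rmorphism fin_ring S -> fin_ring T};
  fin_morE : forall r, fin_hom (fin_str S r) = fin_str T r;
  fin_morP : finite_hom fin_hom
}.

Lemma finite_cover_id (R : comNzRingType) :
  finite_cover (GRing.RMorphism.clone R R idfun _).
Proof.
split=> [|p]; last by exists p.
exists 1%N, (fun=> 1) => x; exists (fun=> x).
by rewrite big_ord1 /= mulr1.
Qed.

(* The terminal object id : X -> X of X_fin. *)
Definition fin_base (R : comNzRingType) : fin_obj R :=
  FinObj (finite_cover_id R).

(* Presheaves of rings; the zero ring is an allowed value. The two laws say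
   that identities and composites are preserved, morphisms of X_fin being
   compared as functions. *)
Record presheaf (R : comNzRingType) := Presheaf {
  psh_obj :> fin_obj R -> comPzRingType;
  psh_map : forall S T : fin_obj R,
    fin_mor S T -> {rmorphism psh_obj S -> psh_obj T};
  psh_id : forall (S : fin_obj R) (u : fin_mor S S),
    u =1 id -> psh_map u =1 id;
  psh_comp : forall (S T V : fin_obj R)
      (u : fin_mor S T) (v : fin_mor T V) (w : fin_mor S V),
    w =1 v \o u -> psh_map w =1 psh_map v \o psh_map u
}.

Record psh_mor (R : comNzRingType) (F G : presheaf R) := PshMor {
  psh_hom :> forall S : fin_obj R, {rmorphism F S -> G S};
  psh_nat : forall (S T : fin_obj R) (u : fin_mor S T) (a : F S),
    psh_hom T (psh_map F u a) = psh_map G u (psh_hom S a)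
}.

(* A section a over Spec T is a matching family for the covering
   Spec T -> Spec S dual to u. *)
Definition matching (R : comNzRingType) (F : presheaf R) (S T : fin_obj R)
    (u : fin_mor S T) (a : F T) : Prop :=
  forall (V : fin_obj R) (g h : fin_mor T V),
    g \o u =1 h \o u -> psh_map F g a = psh_map F h a.

Definition is_sheaf (R : comNzRingType) (F : presheaf R) : Prop :=
  forall (S T : fin_obj R) (u : fin_mor S T), finite_cover u ->
  forall a : F T, matching u a -> exists! s : F S, psh_map F u s = a.

Definition is_sheafification (R : comNzRingType) (P F : presheaf R)
    (eta : psh_mor P F) : Prop :=
  is_sheaf F /\
  forall (G : presheaf R) (phi : psh_mor P G), is_sheaf G ->
    exists psi : psh_mor F G,
      (forall S a, psi S (eta S a) = phi S a) /\
      (forall psi' : psh_mor F G,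
        (forall S a, psi' S (eta S a) = phi S a) ->
        forall S b, psi' S b = psi S b).

Definition structure_presheaf (R : comNzRingType) : presheaf R :=
  @Presheaf R (fun S => fin_ring S : comPzRingType)
    (fun S T u => fin_hom u)
    (fun S u u_id => u_id)
    (fun S T V u v w w_comp => w_comp).

(* P is the tensor product of T with itself over R, with x (x) y given by
   i1 x * i2 y: it is universal for R-balanced biadditive maps. *)
Definition is_tensor_square (R T P : comPzRingType)
    (alpha : {rmorphism R -> T}) (i1 i2 : {rmorphism T -> P}) : Prop :=
  (forall r, i1 (alpha r) = i2 (alpha r)) /\
  forall (M : zmodType) (b : T -> T -> M),
    (forall x, zmod_morphism (b x)) ->
    (forall y, zmod_morphism (b ^~ y)) ->
    (forall x y r, b (x * alpha r) y = b x (alpha r * y)) ->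
    exists h : {additive P -> M},
      (forall x y, h (i1 x * i2 y) = b x y) /\
      (forall h' : {additive P -> M},
        (forall x y, h' (i1 x * i2 y) = b x y) -> h' =1 h).

(* The R-subalgebra T of L is given with its inclusion tau into L. *)
Definition compatible_integral_closure (R L : comNzRingType)
    (phi : {rmorphism R -> L}) (f : L) : Prop :=
  exists (T : comNzRingType) (alpha : {rmorphism R -> T})
         (tau : {rmorphism T -> L}) (t : T),
    [/\ injective tau,
        forall r, tau (alpha r) = phi r,
        finite_hom alpha,
        tau t = f
      & exists (P : comPzRingType) (i1 i2 : {rmorphism T -> P}),
          is_tensor_square alpha i1 i2 /\ nilpotent (i1 t - i2 t)].

(* A natural number n is a [pchar K].-nat when it is a power of the
   characteristic exponent of K: n = 1 in characteristic 0, n = p ^ e in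
   characteristic p. The class of (n, a), for n = p ^ e, is the image of the
   element a of the e-th term of the direct limit of K under Frobenius, that
   is, the n-th root of a. Since Frobenius is injective, (n, a) and (m, b) have
   the same image in the limit iff a ^ m = b ^ n. *)

Module PerfectClosure.
Section PerfectClosure.
Variable K : fieldType.

Definition level := {n : nat | [pchar K].-nat n}.
Definition dom : choiceType := (level * K)%type.
Implicit Types (n m : level) (x y z : dom) (a b : K).

Definition level1 : level := exist (fun k => [pchar K].-nat k) 1%N isT.

Lemma mul_level_subproof n m : [pchar K].-nat (val n * val m)%N.
Proof. by rewrite pnatM (valP n) (valP m). Qed.

Definition mul_level n m : level := 
  exist (fun k => [pchar K].-nat k) _ (mul_level_subproof n m).

Lemma level_inj n : injective (fun a => a ^+ val n).
Proof.
move=> a b /= eq_ab; apply/eqP; rewrite -subr_eq0.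
have : (a - b) ^+ val n == 0.
  by rewrite exprDn_pchar ?(valP n) // exprNn_pchar ?(valP n) // eq_ab subrr.
by rewrite expf_eq0 => /andP[].
Qed.

Definition equiv x y := x.2 ^+ val y.1 == y.2 ^+ val x.1.

Lemma equiv_refl : reflexive equiv.
Proof. by move=> x; rewrite /equiv. Qed.

Lemma equiv_sym : symmetric equiv.
Proof. by move=> x y; rewrite /equiv eq_sym. Qed.

Lemma equiv_trans : transitive equiv.
Proof.
move=> [m b] [n a] [k c]; rewrite /equiv /= => /eqP ab /eqP bc.
apply/eqP/(@level_inj m) => /=.
by rewrite exprAC ab exprAC bc exprAC.
Qed.

Canonical equiv_equiv := EquivRel equiv equiv_refl equiv_sym equiv_trans.

Definition type := {eq_quot equiv}.

HB.instance Definition _ : EqQuotient _ equiv type := EqQuotient.on type.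
HB.instance Definition _ := Choice.on type.

Lemma equiv_repr x :
  (repr (\pi_type x)).2 ^+ val x.1 = x.2 ^+ val (repr (\pi_type x)).1.
Proof.
have /eqmodP : repr (\pi_type x) = x %[mod type] by rewrite reprK.
by move/eqP.
Qed.

Lemma equiv_reprX x (j k c : nat) :
  j = (val (repr (\pi_type x)).1 * c)%N -> k = (val x.1 * c)%N ->
  x.2 ^+ j = (repr (\pi_type x)).2 ^+ k.
Proof. by move=> -> ->; rewrite !exprM equiv_repr. Qed.

Definition embed := lift_embed type (fun a : K => (level1, a) : dom).
Canonical embed_pi_morph := PiEmbed embed.

Definition addp x y : dom :=
  (mul_level x.1 y.1, x.2 ^+ val y.1 + y.2 ^+ val x.1).
Definition add := lift_op2 type addp.

Lemma pi_add : {morph \pi : x y / addp x y >-> add x y}.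
Proof.
move=> x y; unlock add; apply/eqmodP; rewrite /= /equiv /addp /=; apply/eqP.
rewrite !exprDn_pchar ?mul_level_subproof // -!exprM.
set x' := repr (\pi x); set y' := repr (\pi y).
congr (_ + _).
  by apply: (@equiv_reprX _ _ _ (val y.1 * val y'.1)); rewrite -/x'; ring.
by apply: (@equiv_reprX _ _ _ (val x.1 * val x'.1)); rewrite -/y'; ring.
Qed.
Canonical pi_add_morph := PiMorph2 pi_add.

Definition oppp x : dom := (x.1, - x.2).
Definition opp := lift_op1 type oppp.

Lemma pi_opp : {morph \pi : x / oppp x >-> opp x}.
Proof.
move=> x; unlock opp; apply/eqmodP; rewrite /= /equiv /oppp /=; apply/eqP.
by rewrite !exprNn_pchar ?(valP (_ : level)) // equiv_repr.
Qed.
Canonical pi_opp_morph := PiMorph1 pi_opp.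

Definition mulp x y : dom :=
  (mul_level x.1 y.1, x.2 ^+ val y.1 * y.2 ^+ val x.1).
Definition mul := lift_op2 type mulp.

Lemma pi_mul : {morph \pi : x y / mulp x y >-> mul x y}.
Proof.
move=> x y; unlock mul; apply/eqmodP; rewrite /= /equiv /mulp /=; apply/eqP.
rewrite !exprMn -!exprM.
set x' := repr (\pi x); set y' := repr (\pi y).
congr (_ * _).
  by apply: (@equiv_reprX _ _ _ (val y.1 * val y'.1)); rewrite -/x'; ring.
by apply: (@equiv_reprX _ _ _ (val x.1 * val x'.1)); rewrite -/y'; ring.
Qed.
Canonical pi_mul_morph := PiMorph2 pi_mul.

Definition invp x : dom := (x.1, x.2^-1).
Definition inv := lift_op1 type invp.

Lemma pi_inv : {morph \pi : x / invp x >-> inv x}.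
Proof.
move=> x; unlock inv; apply/eqmodP; rewrite /= /equiv /invp /=; apply/eqP.
by rewrite !exprVn equiv_repr.
Qed.
Canonical pi_inv_morph := PiMorph1 pi_inv.

Lemma pi_eq x y : x.2 ^+ val y.1 = y.2 ^+ val x.1 -> \pi_type x = \pi_type y.
Proof. by move=> eq_xy; apply/eqmodP/eqP. Qed.

Lemma pi_eq2 x y :
  val x.1 = val y.1 -> x.2 = y.2 -> \pi_type x = \pi_type y.
Proof. by move=> e1 e2; apply: pi_eq; rewrite e1 e2. Qed.

Lemma addA : associative add.
Proof.
elim/quotW=> x; elim/quotW=> y; elim/quotW=> z; rewrite !piE.
apply: pi_eq2; rewrite /= ?mulnA // !exprDn_pchar ?(valP z.1) ?(valP x.1) //.
by rewrite -!exprM -!addrA [(val z.1 * _)%N]mulnC [(val y.1 * val x.1)%N]mulnC.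
Qed.

Lemma addC : commutative add.
Proof.
elim/quotW=> x; elim/quotW=> y; rewrite !piE; apply: pi_eq => /=.
by rewrite addrC mulnC.
Qed.

Lemma expr0_level n : 0 ^+ val n = 0 :> K.
Proof. by rewrite expr0n; case: n => -[]. Qed.

Lemma add0 : left_id (embed 0) add.
Proof.
elim/quotW=> x; rewrite !piE.
by apply: pi_eq2; rewrite /= ?mul1n // expr0_level add0r expr1.
Qed.

Lemma addN : left_inverse (embed 0) opp add.
Proof.
elim/quotW=> x; rewrite !piE; apply: pi_eq => /=.
rewrite exprNn_pchar ?(valP x.1) // addNr expr1.
by rewrite -[(_ * _)%N]/(val (mul_level _ _)) expr0_level.
Qed.

HB.instance Definition _ := GRing.isZmodule.Build type addA addC add0 addN.

Lemma mulA : associative mul.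
Proof.
elim/quotW=> x; elim/quotW=> y; elim/quotW=> z; rewrite !piE.
apply: pi_eq2; rewrite /= ?mulnA // !exprMn -!exprM -!mulrA.
by rewrite [(val y.1 * val x.1)%N]mulnC [(val z.1 * _)%N]mulnC.
Qed.

Lemma mulC : commutative mul.
Proof.
elim/quotW=> x; elim/quotW=> y; rewrite !piE; apply: pi_eq => /=.
by rewrite mulrC mulnC.
Qed.

Lemma mul1 : left_id (embed 1) mul.
Proof.
elim/quotW=> x; rewrite !piE; apply: pi_eq => /=.
by rewrite expr1n expr1 mul1n mul1r.
Qed.

Lemma mulD : left_distributive mul add.
Proof.
elim/quotW=> x; elim/quotW=> y; elim/quotW=> z; rewrite !piE.
set u := mulp _ _; set v := addp _ _.
have u_v : v.2 = u.2 ^+ val z.1.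
  rewrite /u /v /= !exprDn_pchar ?(valP z.1) // mulrDl.
  rewrite exprDn_pchar ?(valP z.1) // !exprMn -!exprM.
  by congr (_ ^+ _ * _ ^+ _ + _ ^+ _ * _ ^+ _); ring.
by apply: pi_eq; rewrite u_v -exprM; congr (_ ^+ _); rewrite /u /v /=; ring.
Qed.

Lemma nonzero1 : embed 1 != embed 0.
Proof. by rewrite !piE /equiv /= oner_eq0. Qed.

HB.instance Definition _ :=
  GRing.Zmodule_isComNzRing.Build type mulA mulC mul1 mulD nonzero1.

Lemma mulV (c : type) : c != embed 0 -> mul (inv c) c = embed 1.
Proof.
elim/quotW: c => x; rewrite !piE /equiv /= expr0_level expr1 => nz_x.
by apply: pi_eq; rewrite /= exprVn mulVf ?expf_neq0 // expr1n.
Qed.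

Lemma inv0 : inv (embed 0) = embed 0.
Proof. by rewrite !piE; apply: pi_eq; rewrite /= invr0. Qed.

HB.instance Definition _ := GRing.ComNzRing_isField.Build type mulV inv0.

Lemma embed_is_zmod_morphism : zmod_morphism embed.
Proof.
move=> a b; rewrite -[RHS]/(add (embed a) (opp (embed b))) !piE.
by apply: pi_eq2; rewrite /= ?expr1.
Qed.

Lemma embed_is_monoid_morphism : monoid_morphism embed.
Proof.
split=> // a b; rewrite -[RHS]/(mul (embed a) (embed b)) !piE.
by apply: pi_eq2; rewrite /= ?expr1.
Qed.

HB.instance Definition _ :=
  GRing.isZmodMorphism.Build K type embed embed_is_zmod_morphism.
HB.instance Definition _ :=
  GRing.isMonoidMorphism.Build K type embed embed_is_monoid_morphism.

End PerfectClosure.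
End PerfectClosure.
HB.export PerfectClosure.

Definition perfect_closure (K : fieldType) : fieldType := PerfectClosure.type K.

(* The inclusion of R into Q(R)^oo. *)
Definition to_perfect_closure (R : idomainType) :
    {rmorphism R -> perfect_closure {fraction R}} :=
  GRing.RMorphism.clone R (PerfectClosure.type {fraction R})
    (@PerfectClosure.embed {fraction R} \o @FracField.tofrac R) _.

(* R^comp, as a subset of Q(R)^oo. *)
Definition compatible_normalization (R : idomainType) :
    perfect_closure {fraction R} -> Prop :=
  compatible_integral_closure (to_perfect_closure R).

(* Main.v *)
Require Import Defs.
From HB Require Import structures.
From mathcomp Require Import all_boot all_order all_algebra fraction.
From mathcomp Require Import generic_quotient ring_quotient ring.
From mathcomp Require Import boolp classical_sets.

Set Implicit Arguments.
Unset Strict Implicit.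
Unset Printing Implicit Defensive.

Import GRing.Theory.
Local Open Scope ring_scope.

(* A section over S is locally an element t of a finite cover T of S whose
   images under any two morphisms from T that agree on S differ by a nilpotent.
   These elements, identified when they agree up to nilpotents on a common
   cover, already form the sheafification: finite covers are stable under base
   change, and they reflect nilpotency since they are surjective on spectra.
   When R is a domain, a section can be represented on a domain R[t] finite over
   R, as injective finite maps are covers. If m is a minimal equation of t over
   K = Q(R), the nilpotency of t (x) 1 - 1 (x) t makes m divide a power of
   X - t over K(t), so m = (X - t)^d, and a coefficient of m shows that some
   power t^n, with n a power of the characteristic exponent, lies in K. Hence
   R[t] embeds into Q(R)^oo, and the image of t is the value of the section. *)

(** * Nilpotents, ideals and quotients *)

(** Matching is only required up to nilpotents because dividing a ring by its nilradical is itself a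
    finite cover: every sheaf identifies two elements whose difference is nilpotent.

    The delicate point about base change is surjectivity on spectra, since the tensor product is
    known only through balanced maps. The bridge is a linear functional: a prime of T over a prime
    of S gives an S-linear map from T to a field K that takes 1 to 1, and such a map extends to the
    tensor product and witnesses a nonempty fibre.

    Denominators are avoided throughout. The minimal equation of t is kept with coefficients in R,
    division by it being pseudo-division. The copy of R[t] in an abstract field is compared with its
    copy in Q(R)^oo through a relation with coefficients in R, so that no map between the two fields
    has to be built.

    Conversely, a finite subalgebra T of Q(R)^oo is a cover of R, and nilpotency of t (x) 1 - 1 (x)
    t is the universal case of weak matching. The result passes to an arbitrary sheafification by
    uniqueness up to isomorphism. *)

Lemma rmorphism_of (A B : pzRingType) (f : A -> B) :
  zmod_morphism f -> monoid_morphism f ->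
  exists F : {rmorphism A -> B}, F =1 f.
Proof.
move=> fB fM; pose add := GRing.isZmodMorphism.Build A B f fB.
pose mul := GRing.isMonoidMorphism.Build A B f fM.
by exists (HB.pack f add mul : {rmorphism A -> B}).
Qed.

Lemma rmorphism_inj (A B : pzRingType) (f : {rmorphism A -> B}) :
  (forall x, f x = 0 -> x = 0) -> injective f.
Proof.
move=> f0 x y fxy; apply/eqP; rewrite -subr_eq0; apply/eqP/f0.
by rewrite rmorphB fxy subrr.
Qed.

Lemma additive_of (A B : zmodType) (f : A -> B) :
  zmod_morphism f -> exists F : {additive A -> B}, F =1 f.
Proof.
move=> fB; pose add := GRing.isZmodMorphism.Build A B f fB.
by exists (HB.pack f add : {additive A -> B}).
Qed.

Section Nilpotent.
Variable A : comPzRingType.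
Implicit Types x y : A.

Lemma nilpotent0 : nilpotent (0 : A).
Proof. by exists 1%N; rewrite expr1. Qed.

Lemma nilpotentD x y : nilpotent x -> nilpotent y -> nilpotent (x + y).
Proof.
move=> [m xm0] [n yn0]; exists (m + n)%N; rewrite exprDn big1 // => -[i /= _] _.
have [le_ni | lt_in] := leqP n i.
  by rewrite -(subnK le_ni) [y ^+ _]exprD yn0 !mulr0 mul0rn.
have -> : (m + n - i = (n - i) + m)%N by rewrite addnC addnBAC // ltnW.
by rewrite exprD xm0 mulr0 mul0r mul0rn.
Qed.

Lemma nilpotentMl x y : nilpotent y -> nilpotent (x * y).
Proof. by case=> n yn0; exists n; rewrite exprMn yn0 mulr0. Qed.

Lemma nilpotentMr x y : nilpotent x -> nilpotent (x * y).
Proof. by rewrite mulrC; apply: nilpotentMl. Qed.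

Lemma nilpotentN x : nilpotent x -> nilpotent (- x).
Proof. by rewrite -mulN1r; apply: nilpotentMl. Qed.

Lemma nilpotentBC x y : nilpotent (x - y) -> nilpotent (y - x).
Proof. by move/nilpotentN; rewrite opprB. Qed.

Lemma nilpotent_trans y x z :
  nilpotent (x - y) -> nilpotent (y - z) -> nilpotent (x - z).
Proof. by move=> xy /(nilpotentD xy); rewrite addrA subrK. Qed.

Lemma nilpotentX n x : nilpotent (x ^+ n) -> nilpotent x.
Proof. by case=> m; rewrite -exprM; exists (n * m)%N. Qed.

Lemma nilpotentBM x y x' y' : nilpotent (x - x') -> nilpotent (y - y') ->
  nilpotent (x * y - x' * y').
Proof.
move=> x0 y0; apply: (@nilpotent_trans (x' * y)).
  by rewrite -mulrBl; apply: nilpotentMr.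
by rewrite -mulrBr; apply: nilpotentMl.
Qed.

Lemma nilpotentBD x y x' y' : nilpotent (x - x') -> nilpotent (y - y') ->
  nilpotent (x + y - (x' + y')).
Proof. by move=> x0 y0; rewrite opprD addrACA; apply: nilpotentD. Qed.

End Nilpotent.

Lemma nilpotent_rmorph (A B : pzRingType) (f : {rmorphism A -> B}) x :
  nilpotent x -> nilpotent (f x).
Proof. by case=> n xn0; exists n; rewrite -rmorphXn xn0 rmorph0. Qed.

Lemma nilpotent_eq0 (K : idomainType) (x : K) : nilpotent x -> x = 0.
Proof. by case=> n /eqP; rewrite expf_eq0 => /andP[_ /eqP]. Qed.

Lemma nilpotent_prime (A : comNzRingType) (p : prime_idealr A) x :
  nilpotent x -> x \in p.
Proof.
case=> n; elim: n x => [x /eqP|n IHn x].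
  by rewrite expr0 (negPf (oner_neq0 _)).
move/eqP; rewrite exprS => xn0; have: x * x ^+ n \in p.
  by rewrite (eqP xn0) idealr0.
rewrite prime_idealrM => /orP[//|]; elim: {xn0 IHn} n => [|n IHn].
  by rewrite expr0 idealr1.
by rewrite exprS prime_idealrM => /orP[].
Qed.

Definition submodule (S T : comPzRingType) (u : S -> T) (N : T -> Prop) : Prop :=
  [/\ N 0, forall x y, N x -> N y -> N (x + y) & forall s x, N x -> N (u s * x)].

Lemma submoduleN (S T : comPzRingType) (u : {rmorphism S -> T}) N x :
  submodule u N -> N x -> N (- x).
Proof. by case=> _ _ NZ /(NZ (-1)); rewrite rmorphN1 mulN1r. Qed.

Lemma submoduleB (S T : comPzRingType) (u : {rmorphism S -> T}) N x y :
  submodule u N -> N x -> N y -> N (x - y).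
Proof. by move=> Nu Nx /(submoduleN Nu); case: Nu => _ ND _; apply: ND. Qed.

(** Zorn's lemma in a form that serves twice: with [u] the identity and [E] multiplicative, [N] will
    be a prime ideal; with a general [u], the quotient by [N] will have rank one. The last clause is
    maximality tested against N + u(S)t. *)
Lemma max_submodule (S T : comPzRingType) (u : {rmorphism S -> T})
    (N0 E : T -> Prop) :
  submodule u N0 -> (forall x, N0 x -> ~ E x) ->
  exists N : T -> Prop,
    [/\ submodule u N, forall x, N0 x -> N x, forall x, N x -> ~ E x
      & forall t, ~ N t -> exists2 n, N n & exists s, E (n + u s * t)].
Proof.
move=> sub0 dis0.
pose good N :=
  [/\ submodule u N, forall x, N0 x -> N x & forall x, N x -> ~ E x].
have [F FP Ftot|A [PA Amax]] :=
    @Zorn_bigcup T [set N | N = set0 \/ good N]%classic.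
  have [[X FX goodX]|noX] := pselect (exists2 X, F X & good X); last first.
    left; rewrite predeqE => x; split=> // -[X FX Xx].
    by case: (FP X FX) Xx => [->//|goodX]; case: noX; exists X.
  right; split=> [|x /(let: And3 _ h _ := goodX in h x)|x [Y FY Yx]].
  - split; first by exists X => //; case: goodX => -[].
    + move=> x y [Y FY Yx] [Z FZ Zy].
      have [Y0|[[_ YD _] _ _]] := FP Y FY; first by rewrite Y0 in Yx.
      have [Z0|[[_ ZD _] _ _]] := FP Z FZ; first by rewrite Z0 in Zy.
      have [sYZ|sZY] := Ftot Y Z FY FZ.
        by exists Z => //; apply: ZD => //; apply: sYZ.
      by exists Y => //; apply: YD => //; apply: sZY.
    + move=> s x [Y FY Yx].
      have [Y0|[[_ _ YZ] _ _]] := FP Y FY; first by rewrite Y0 in Yx.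
      by exists Y => //; apply: YZ.
  - by exists X.
  - have [Y0|[_ _ Ydis]] := FP Y FY; first by rewrite Y0 in Yx.
    exact: Ydis.
have good0 : good N0 by [].
have goodA : good A.
  case: PA => // A0; case: (Amax N0); last by right.
  rewrite A0; split=> // /(_ 0); apply; by case: sub0.
exists A; case: (goodA) => -[A0 AD AZ] sA disA; split=> // t nAt.
apply: contrapT => noE; case: (Amax [set x | exists2 n, A n &
    exists s, x = n + u s * t]%classic).
  split=> [x Ax|/(_ t) sub]; first by exists x => //; exists 0;
    rewrite rmorph0 mul0r addr0.
  by apply: nAt; apply: sub; exists 0 => //; exists 1; rewrite rmorph1 mul1r add0r.
right; split.
- split.
  + by exists 0 => //; exists 0; rewrite rmorph0 mul0r addr0.
  + move=> _ _ [n An [s ->]] [m Am [r ->]]; exists (n + m); first exact: AD.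
    by exists (s + r); rewrite rmorphD mulrDl addrACA.
  + move=> r _ [n An [s ->]]; exists (u r * n); first exact: AZ.
    by exists (r * s); rewrite rmorphM mulrDr mulrA.
- move=> x /sA Ax; exists x => //; exists 0; by rewrite rmorph0 mul0r addr0.
- by move=> _ [n An [s ->]] Ent; apply: noE; exists n => //; exists s.
Qed.

Section IdealOf.
Variables (A : comNzRingType) (N : A -> Prop).
Hypothesis idN : submodule (@idfun A) N.
Hypothesis N1 : ~ N 1.

(** The two proofs are phantom arguments, so that the ideal instance declared on this predicate can
    recover them. *)
Definition ideal_of (_ : submodule (@idfun A) N) (_ : ~ N 1) : A -> bool :=
  fun x => `[< N x >].

Lemma ideal_of_closed : idealr_closed (ideal_of idN N1).
Proof.
case: (idN) => N0 ND NM; split; first exact/asboolP.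
  exact/asboolPn.
move=> a x y /asboolP Nx /asboolP Ny; apply/asboolP.
by apply: ND => //; apply: NM.
Qed.

HB.instance Definition _ :=
  isIdealr.Build A (ideal_of idN N1) ideal_of_closed.

Lemma prime_ideal_of :
  (forall x y, N (x * y) -> N x \/ N y) ->
  exists p : prime_idealr A, forall x, (x \in p) <-> N x.
Proof.
move=> prN.
have prP : prime_idealr_closed (ideal_of idN N1).
  move=> x y /asboolP /prN[] ?; apply/orP; [left | right]; exact/asboolP.
pose pr := isPrimeIdealrClosed.Build A (ideal_of idN N1) prP.
exists (HB.pack (ideal_of idN N1) pr : prime_idealr A) => x.
by split=> /asboolP.
Qed.

Lemma quotient_ring : exists (Q : comNzRingType) (pi : {rmorphism A -> Q}),
  (forall y, exists x, pi x = y) /\ (forall x, pi x = 0 <-> N x).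
Proof.
pose J : idealr A := Idealr.clone A (ideal_of idN N1) _.
pose Q : comNzRingType := {ideal_quot J}.
exists Q, (\pi_Q)%qT; split=> [y|x]; first by exists (repr y); exact: reprK.
have <- : (x \in J) <-> N x by split=> /asboolP.
rewrite -[x in x \in _]subr0 Quotient.idealrBE.
by rewrite (rmorph0 (\pi_Q)%qT); split=> /eqP.
Qed.

End IdealOf.

Lemma prime_avoiding (A : comNzRingType) (N E : A -> Prop) :
  submodule (@idfun A) N -> E 1 -> (forall x y, E x -> E y -> E (x * y)) ->
  (forall x, N x -> ~ E x) ->
  exists p : prime_idealr A, (forall x, N x -> x \in p)
    /\ (forall x, E x -> x \notin p).
Proof.
move=> idN E1 EM disN.
have [M [idM sNM disM maxM]] := @max_submodule A A idfun N E idN disN.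
case: (idM) => M0 MD MM.
have M1 : ~ M 1 by move/disM.
have [x y Mxy|p pP] := prime_ideal_of idM M1.
  apply: contrapT => /not_orP[/maxM[m Mm [s Es]] /maxM[n Mn [r Er]]].
  apply: (disM _ _ (EM _ _ Es Er)); rewrite /= mulrDl !mulrDr.
  apply: (MD); first by apply: (MD); [exact: (MM) | rewrite mulrC; exact: (MM)].
  apply: (MD); first exact: (MM).
  by rewrite mulrACA; apply: (MM).
exists p; split=> x; first by move/sNM/pP.
by move=> Ex; apply/negP => /pP /disM.
Qed.

Lemma exists_prime (A : comNzRingType) (x : A) :
  ~ nilpotent x -> exists p : prime_idealr A, x \notin p.
Proof.
move=> nx.
have [|||y -> [n xn0]|p [_ pE]] := @prime_avoiding A (fun y => y = 0)
    (fun y => exists n, y = x ^+ n).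
- by split=> [//|y z -> ->|s y ->]; rewrite ?addr0 ?mulr0.
- by exists 0%N.
- by move=> _ _ [m ->] [n ->]; exists (m + n)%N; rewrite exprD.
- by apply: nx; exists n.
by exists p; apply: pE; exists 1%N; rewrite expr1.
Qed.

Section Factor.
Variables (A B C : comPzRingType) (pi : {rmorphism A -> B}).
Variables (f : {rmorphism A -> C}).
Hypothesis pi_surj : forall y, exists x, pi x = y.

Lemma factor_rmorphism : (forall x, pi x = 0 -> f x = 0) ->
  exists g : {rmorphism B -> C}, forall x, g (pi x) = f x.
Proof.
move=> ker; have [h hK] := choice pi_surj.
have fE x y : pi x = pi y -> f x = f y.
  move=> e; apply/eqP; rewrite -subr_eq0 -rmorphB; apply/eqP/ker.
  by rewrite rmorphB e subrr.
have [||g gE] := @rmorphism_of B C (f \o h).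
- by move=> x y /=; rewrite -rmorphB; apply: fE; rewrite rmorphB !hK.
- split=> [|x y] /=; first by rewrite -(rmorph1 f); apply: fE; rewrite hK rmorph1.
  by rewrite -rmorphM; apply: fE; rewrite rmorphM !hK.
by exists g => x; rewrite gE; apply: fE; rewrite hK.
Qed.

End Factor.

Module ClassicalDomain.
Section ClassicalDomain.
Variable A : comNzRingType.
Hypothesis domA : forall x y : A, x * y = 0 -> (x == 0) || (y == 0).

(** A copy of [A] that carries its integrality as a phantom argument. Units and inverses are chosen
    classically, to make it an [idomainType] and give it a fraction field. *)
Definition type (_ : forall x y : A, x * y = 0 -> (x == 0) || (y == 0)) : Type :=
  A.
Local Notation D := (type domA).
HB.instance Definition _ := GRing.ComNzRing.on D.

Definition unit (x : D) := `[< exists y, y * x = 1 >].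
Definition inv (x : D) : D := if pselect (exists y, y * x = 1) is left e
  then projT1 (cid e) else x.

Lemma mulVx : {in unit, left_inverse 1 inv *%R}.
Proof.
by move=> x /asboolP ex; rewrite /inv; case: pselect => // e; case: (cid e).
Qed.

Lemma unitPl (x y : D) : y * x = 1 -> unit x.
Proof. by move=> e; apply/asboolP; exists y. Qed.

Lemma invx_out : {in [predC unit], inv =1 id}.
Proof. by move=> x /asboolP; rewrite /inv; case: pselect. Qed.

HB.instance Definition _ :=
  GRing.ComNzRing_hasMulInverse.Build D mulVx unitPl invx_out.

HB.instance Definition _ := GRing.ComUnitRing_isIntegral.Build D domA.

End ClassicalDomain.
End ClassicalDomain.
HB.export ClassicalDomain.

Lemma residue_field (A : comNzRingType) (p : prime_idealr A) :
  exists (K : fieldType) (f : {rmorphism A -> K}), forall x, (x \in p) = (f x == 0).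
Proof.
pose Q : comNzRingType := {ideal_quot p}.
have domQ (x y : Q) : x * y = 0 -> (x == 0) || (y == 0).
  exact: Quotient.rquot_IdomainAxiom.
pose D : idomainType := ClassicalDomain.type domQ.
have pi0 x : (x \in p) = (\pi_Q x == 0)%qT.
  by rewrite -[x in x \in _]subr0 Quotient.idealrBE (rmorph0 (\pi_Q)%qT).
exists {fraction D}, (@FracField.tofrac D \o (\pi_Q : {rmorphism A -> Q}))%qT.
by move=> x; rewrite /= pi0 -(tofrac_eq0 (_ : D)).
Qed.

(** * Tensor products *)

Module Tensor.
Section Tensor.
Variables (S A B : comPzRingType).
Variables (alpha : {rmorphism S -> A}) (beta : {rmorphism S -> B}).

Record balanced (M : zmodType) (b : A -> B -> M) : Prop := Balanced {
  balancedl : forall x, zmod_morphism (b x);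
  balancedr : forall y, zmod_morphism (b ^~ y);
  balancedM : forall x y s, b (x * alpha s) y = b x (beta s * y)
}.

Definition ev (M : zmodType) (b : A -> B -> M) (s : seq (A * B)) : M :=
  \sum_(p <- s) b p.1 p.2.

(* The quantification over all balanced maps is impredicative, so that the
   tensor product is a quotient of the formal sums of pure tensors by exactly
   the identifications that its universal property imposes. *)
Definition same (s t : seq (A * B)) : bool :=
  `[< forall (M : zmodType) (b : A -> B -> M), balanced b -> ev b s = ev b t >].

Lemma same_refl : reflexive same.
Proof. by move=> s; apply/asboolP. Qed.

Lemma same_sym : symmetric same.
Proof.
by move=> s t; apply/asboolP/asboolP => st M b bb; rewrite st.
Qed.

Lemma same_trans : transitive same.
Proof.
move=> s r t /asboolP rs /asboolP st; apply/asboolP => M b bb.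
by rewrite rs ?st.
Qed.

Canonical same_equiv := EquivRel same same_refl same_sym same_trans.

Definition type := {eq_quot same}%qT.
HB.instance Definition _ := Choice.on type.

Definition Ev (M : zmodType) (b : A -> B -> M) (x : type) : M := ev b (repr x).

Lemma Ev_pi (M : zmodType) (b : A -> B -> M) s :
  balanced b -> Ev b (\pi_type s)%qT = ev b s.
Proof.
move=> bb; have /eqmodP/asboolP e : (repr (\pi_type s) = s %[mod type])%qT.
  by rewrite reprK.
exact: e.
Qed.

(** Equality is tested on balanced maps, which turns every ring axiom of the tensor product into an
    identity between finite sums in a group. *)
Lemma type_ext (x y : type) :
  (forall (M : zmodType) (b : A -> B -> M), balanced b -> Ev b x = Ev b y) ->
  x = y.
Proof.
by move=> xy; rewrite -[x]reprK -[y]reprK; apply/eqmodP/asboolP.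
Qed.

Definition pure (a : A) (c : B) : type := (\pi_type [:: (a, c)])%qT.
Definition zero : type := (\pi_type [::])%qT.
Definition add (x y : type) : type := (\pi_type (repr x ++ repr y))%qT.
Definition opp (x : type) : type :=
  (\pi_type [seq (- p.1, p.2) | p <- repr x])%qT.
Definition mul (x y : type) : type :=
  (\pi_type [seq (p.1 * q.1, p.2 * q.2) | p <- repr x, q <- repr y])%qT.

Section Eval.
Variables (M : zmodType) (b : A -> B -> M).
Hypothesis bb : balanced b.

Lemma balanced_mul a c : balanced (fun x y => b (a * x) (c * y)).
Proof.
case: bb => bl br bM; split=> [x y z|y x z|x y s].
- by rewrite mulrBr bl.
- by rewrite mulrBr br.
- by rewrite mulrA bM mulrCA.
Qed.

Lemma Ev_pure a c : Ev b (pure a c) = b a c.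
Proof. by rewrite Ev_pi // /ev big_seq1. Qed.

Lemma Ev0 : Ev b zero = 0.
Proof. by rewrite Ev_pi // /ev big_nil. Qed.

Lemma EvD x y : Ev b (add x y) = Ev b x + Ev b y.
Proof. by rewrite Ev_pi // /ev big_cat. Qed.

Lemma EvN x : Ev b (opp x) = - Ev b x.
Proof.
rewrite Ev_pi // /ev big_map /= -sumrN; apply: eq_bigr => p _.
have b0 : b 0 p.2 = 0 by have := balancedr bb p.2 0 0; rewrite !subrr.
by have /= := balancedr bb p.2 0 p.1; rewrite b0 !sub0r.
Qed.

Lemma EvM x y :
  Ev b (mul x y) = \sum_(p <- repr x) Ev (fun a c => b (p.1 * a) (p.2 * c)) y.
Proof. by rewrite Ev_pi // /ev big_allpairs_dep. Qed.

End Eval.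

Lemma addA : associative add.
Proof. by move=> x y z; apply: type_ext => M b bb; rewrite !EvD // addrA. Qed.

Lemma addC : commutative add.
Proof. by move=> x y; apply: type_ext => M b bb; rewrite !EvD // addrC. Qed.

Lemma add0 : left_id zero add.
Proof. by move=> x; apply: type_ext => M b bb; rewrite EvD // Ev0 // add0r. Qed.

Lemma addN : left_inverse zero opp add.
Proof.
by move=> x; apply: type_ext => M b bb; rewrite EvD // EvN // Ev0 // addNr.
Qed.

HB.instance Definition _ := GRing.isZmodule.Build type addA addC add0 addN.

Lemma mulC : commutative mul.
Proof.
move=> x y; apply: type_ext => M b bb; rewrite !EvM // /Ev /ev exchange_big /=.
apply: eq_bigr => p _; apply: eq_bigr => q _.
by rewrite mulrC [q.2 * _]mulrC.
Qed.

Lemma mulA : associative mul.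
Proof.
(* [EvM] expands the left factor only; turning the right-hand side around puts its inner product on
   the right, where [EvM] applies again. *)
move=> x y z; rewrite [RHS]mulC; apply: type_ext => M b bb; rewrite !EvM //.
under eq_bigr => p _ do rewrite (EvM (balanced_mul bb _ _)).
under [RHS]eq_bigr => p _ do rewrite (EvM (balanced_mul bb _ _)).
rewrite [RHS]exchange_big; apply: eq_bigr => p _.
rewrite [RHS]exchange_big; apply: eq_bigr => q _.
rewrite /Ev /ev; apply: eq_bigr => r _ /=.
by congr (b _ _); rewrite mulrA [RHS]mulrC.
Qed.

Lemma mul1 : left_id (pure 1 1) mul.
Proof.
move=> x; rewrite mulC; apply: type_ext => M b bb; rewrite EvM //.
rewrite {2}/Ev /ev; apply: eq_bigr => p _.
by rewrite Ev_pure ?mulr1 //; apply: balanced_mul.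
Qed.

Lemma mulD : left_distributive mul add.
Proof.
move=> x y z; rewrite mulC [mul x z]mulC [mul y z]mulC.
apply: type_ext => M b bb; rewrite EvD // !EvM // -big_split.
by apply: eq_bigr => p _; rewrite EvD //; apply: balanced_mul.
Qed.

HB.instance Definition _ :=
  GRing.Zmodule_isComPzRing.Build type mulA mulC mul1 mulD.

Lemma pureM a c a' c' : pure a c * pure a' c' = pure (a * a') (c * c').
Proof.
apply: type_ext => M b bb; rewrite Ev_pure // EvM //.
rewrite -[LHS]/(ev (fun a1 c1 => Ev (fun x y => b (a1 * x) (c1 * y))
  (pure a' c')) (repr (pure a c))).
under [LHS]eq_bigr => p _ do rewrite (Ev_pure (balanced_mul bb _ _)).
have bbr : balanced (fun x y => b (x * a') (y * c')).
  rewrite (_ : (fun x y => _) = fun x y => b (a' * x) (c' * y)).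
    exact: balanced_mul.
  by apply/funext => x; apply/funext => y; rewrite mulrC [y * _]mulrC.
exact: (Ev_pure bbr).
Qed.

Lemma pureBl c : zmod_morphism (pure ^~ c).
Proof.
move=> x y; apply: type_ext => M b bb.
by rewrite (EvD bb) (EvN bb) !Ev_pure // (balancedr bb).
Qed.

Lemma pureBr a : zmod_morphism (pure a).
Proof.
move=> x y; apply: type_ext => M b bb.
by rewrite (EvD bb) (EvN bb) !Ev_pure // (balancedl bb).
Qed.

Lemma pure_sum (x : type) : x = \sum_(p <- repr x) pure p.1 p.2.
Proof.
apply: type_ext => M b bb; rewrite {1}/Ev /ev.
elim: (repr x) => [|p s IHs]; first by rewrite !big_nil (Ev0 bb).
by rewrite !big_cons (EvD bb) Ev_pure // IHs.
Qed.

End Tensor.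
End Tensor.
HB.export Tensor.

Definition is_tensor (S A B W : comPzRingType) (alpha : {rmorphism S -> A})
    (beta : {rmorphism S -> B}) (i : {rmorphism A -> W}) (j : {rmorphism B -> W}) :
    Prop :=
  (forall s, i (alpha s) = j (beta s)) /\
  forall (M : zmodType) (b : A -> B -> M),
    (forall x, zmod_morphism (b x)) ->
    (forall y, zmod_morphism (b ^~ y)) ->
    (forall x y s, b (x * alpha s) y = b x (beta s * y)) ->
    exists h : {additive W -> M},
      (forall x y, h (i x * j y) = b x y) /\
      (forall h' : {additive W -> M},
        (forall x y, h' (i x * j y) = b x y) -> h' =1 h).

(** The result is only a [comPzRingType] because a tensor product may vanish, as Z/2 (x) Z/3 does
    over Z. *)
Lemma tensor_product (S A B : comPzRingType) (alpha : {rmorphism S -> A})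
    (beta : {rmorphism S -> B}) :
  exists (W : comPzRingType) (i : {rmorphism A -> W}) (j : {rmorphism B -> W}),
    is_tensor alpha beta i j /\
    forall w, exists s : seq (A * B), w = \sum_(p <- s) i p.1 * j p.2.
Proof.
pose W : comPzRingType := Tensor.type alpha beta.
pose pure := @Tensor.pure _ _ _ alpha beta.
have [||i iE] := @rmorphism_of A W (fun a => pure a 1).
- exact: Tensor.pureBl.
- by split=> // x y; rewrite [RHS]Tensor.pureM mulr1.
have [||j jE] := @rmorphism_of B W (fun c => pure 1 c).
- exact: Tensor.pureBr.
- by split=> // x y; rewrite [RHS]Tensor.pureM mulr1.
have ijE x y : i x * j y = pure x y.
  by rewrite iE jE [LHS]Tensor.pureM mulr1 mul1r.
exists W, i, j; split=> [|w]; last first.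
  exists (repr w); rewrite [LHS]Tensor.pure_sum.
  by apply: eq_bigr => p _; rewrite ijE.
split=> [s|M b bl br bM].
  rewrite iE jE; apply: Tensor.type_ext => M b [bl br bM].
  by rewrite !Tensor.Ev_pure // -[alpha s]mul1r bM mulr1.
have bb : Tensor.balanced alpha beta b by [].
have [|h hE] := @additive_of W M (Tensor.Ev b).
  by move=> x y; rewrite [LHS]Tensor.EvD // [X in _ + X]Tensor.EvN.
exists h; split=> [x y|h' h'E x].
  by rewrite ijE hE [LHS]Tensor.Ev_pure.
rewrite (Tensor.pure_sum x) !raddf_sum; apply: eq_bigr => p _ /=.
by rewrite -[Tensor.pure _ _ _ _]ijE h'E ijE hE [RHS]Tensor.Ev_pure.
Qed.

(** * Finite covers *)

Lemma finite_hom_fintype (R S : comNzRingType) (u : {rmorphism R -> S})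
    (I : finType) (g : I -> S) :
  (forall x, exists c : I -> R, x = \sum_i u (c i) * g i) -> finite_hom u.
Proof.
move=> gP; exists #|I|, (g \o enum_val) => x; have [c ->] := gP x.
exists (c \o enum_val) => /=.
rewrite (reindex (enum_val : 'I_#|I| -> I)) //=.
by exists enum_rank => i _; rewrite (enum_valK, enum_rankK).
Qed.

Lemma finite_hom_comp (R S T : comNzRingType) (u : {rmorphism R -> S})
    (v : {rmorphism S -> T}) (w : {rmorphism R -> T}) :
  w =1 v \o u -> finite_hom u -> finite_hom v -> finite_hom w.
Proof.
move=> wE [n [g gP]] [m [h hP]].
apply: (@finite_hom_fintype _ _ _ _ (fun ij : 'I_n * 'I_m => v (g ij.1) * h ij.2)).
move=> x; have [c ->] := hP x; have [d dP] := choice (fun j => gP (c j)).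
exists (fun ij => d ij.2 ij.1).
rewrite -(pair_bigA _ (fun i j => w (d j i) * (v (g i) * h j))) exchange_big /=.
apply: eq_bigr => j _; rewrite dP rmorph_sum mulr_suml.
by apply: eq_bigr => i _; rewrite rmorphM wE mulrA.
Qed.

Lemma finite_hom_surj (R S : comNzRingType) (u : {rmorphism R -> S}) :
  (forall y, exists x, u x = y) -> finite_hom u.
Proof.
move=> uP; exists 1%N, (fun=> 1) => y; have [x <-] := uP y.
by exists (fun=> x); rewrite big_ord1 mulr1.
Qed.

Lemma finite_hom_right (R S T : comNzRingType) (u : {rmorphism R -> S})
    (v : {rmorphism S -> T}) (w : {rmorphism R -> T}) :
  w =1 v \o u -> finite_hom w -> finite_hom v.
Proof.
move=> wE [n [g gP]]; exists n, g => x; have [c ->] := gP x.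
by exists (u \o c); apply: eq_bigr => i _; rewrite wE.
Qed.

Lemma spec_surjective_comp (R S T : comNzRingType) (u : {rmorphism R -> S})
    (v : {rmorphism S -> T}) (w : {rmorphism R -> T}) :
  w =1 v \o u -> spec_surjective u -> spec_surjective v -> spec_surjective w.
Proof.
move=> wE us vs p; have [q pq] := us p; have [r qr] := vs q; exists r => x.
by rewrite pq qr wE.
Qed.

Lemma finite_cover_comp (R S T : comNzRingType) (u : {rmorphism R -> S})
    (v : {rmorphism S -> T}) (w : {rmorphism R -> T}) :
  w =1 v \o u -> finite_cover u -> finite_cover v -> finite_cover w.
Proof.
move=> wE [uf us] [vf vs]; split; first exact: (finite_hom_comp wE).
exact: (spec_surjective_comp wE).
Qed.

Lemma finite_cover_ext (A B : comNzRingType) (u v : {rmorphism A -> B}) :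
  u =1 v -> finite_cover u -> finite_cover v.
Proof.
move=> uv [[n [g gP]] us]; split=> [|p].
  exists n, g => x; have [c ->] := gP x; exists c.
  by apply: eq_bigr => i _; rewrite uv.
by have [q pq] := us p; exists q => x; rewrite pq uv.
Qed.

Section DeterminantTrick.
Variables (R S : comNzRingType) (u : {rmorphism R -> S}).
Variables (n : nat) (g : 'I_n -> S).
Hypothesis gP : forall x, exists c : 'I_n -> R, x = \sum_i u (c i) * g i.

(** The matrix t - u(A) kills the column of generators. Multiplying by its adjugate, its determinant
    kills each generator, hence also 1. *)
Lemma determinant_trick (A : 'M[R]_n) (t : S) :
  (forall i, t * g i = \sum_j u (A i j) * g j) ->
  (map_poly u (char_poly A)).[t] = 0.
Proof.
move=> tg; pose M := t%:M - map_mx u A.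
have detM : \det M = (map_poly u (char_poly A)).[t].
  rewrite map_char_poly /char_poly -horner_evalE -det_map_mx; congr (\det _).
  apply/matrixP => i j; rewrite !mxE /= /horner_eval !hornerE.
  by rewrite hornerMn hornerX.
have Mg : M *m (\col_i g i) = 0.
  apply/matrixP => i j; rewrite mulmxBl mul_scalar_mx !mxE tg; apply/eqP.
  by rewrite subr_eq0; apply/eqP/eq_bigr => k _; rewrite !mxE.
have detg i : \det M * g i = 0.
  have := congr1 (fun B => (\adj M *m B) i ord0) Mg.
  by rewrite /= mulmxA mul_adj_mx mulmx0 mul_scalar_mx !mxE.
have [c c1] := gP 1; rewrite -detM -[\det M]mulr1 c1 mulr_sumr big1 // => i _.
by rewrite mulrCA detg mulr0.
Qed.

End DeterminantTrick.

Lemma finite_hom_integral (R S : comNzRingType) (u : {rmorphism R -> S}) t :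
  finite_hom u -> exists2 p : {poly R}, p \is monic & (map_poly u p).[t] = 0.
Proof.
move=> [n [g gP]]; have [c cP] := choice (fun i => gP (t * g i)).
exists (char_poly (\matrix_(i, j) c i j)); first exact: char_poly_monic.
apply: (determinant_trick gP) => i; rewrite cP.
by apply: eq_bigr => j _; rewrite mxE.
Qed.

(** A prime of S that contains pS and avoids the image of the complement of p contracts to p, so pS
    has to miss that image. If u(s) lies in pS, then s acts on the generators by a matrix A with
    entries in p. The determinant trick makes chi_A(s) nilpotent, hence a member of p; modulo p it
    is s^n, so s lies in p. *)
Lemma lying_over (R S : comNzRingType) (u : {rmorphism R -> S}) :
  finite_hom u -> (forall x, u x = 0 -> nilpotent x) -> spec_surjective u.
Proof.
move=> uf ker p; have [n [g gP]] := uf.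
pose N x := exists2 c : 'I_n -> R, forall i, c i \in p & x = \sum_i u (c i) * g i.
have ND x y : N x -> N y -> N (x + y).
  move=> [c cp ->] [d dp ->]; exists (fun i => c i + d i) => [i|].
    by rewrite rpredD.
  by rewrite -big_split; apply: eq_bigr => i _; rewrite rmorphD mulrDl.
have N0 : N 0.
  exists (fun=> 0) => [i|]; first exact: idealr0.
  by rewrite big1 // => i _; rewrite rmorph0 mul0r.
have Ng c x : c \in p -> N (u c * x).
  move=> cp; have [d ->] := gP x; exists (fun i => c * d i) => [i|].
    by rewrite mulrC idealMr.
  by rewrite mulr_sumr; apply: eq_bigr => i _; rewrite rmorphM mulrA.
have idN : submodule (@idfun S) N.
  split=> // s _ [c cp ->] /=; rewrite mulr_sumr.
  by elim/big_ind: _ => // i _; rewrite mulrCA; apply: Ng.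
have disN x : N x -> ~ exists2 s, s \notin p & x = u s.
  move=> Nx [s sp xs]; rewrite {x}xs in Nx.
  have /choice[c cP] i : exists c : 'I_n -> R, (forall j, c j \in p) /\
      u s * g i = \sum_j u (c j) * g j.
    by case: idN => _ _ /(_ (g i)) /(_ _ Nx)[c cp e]; exists c; rewrite -e mulrC.
  pose A := \matrix_(i, j) c i j.
  have /= := @determinant_trick _ _ u n g gP A (u s).
  rewrite horner_map => /(_ _)/ker -/(_ _)/(nilpotent_prime p) ps.
  have {}ps : (char_poly A).[s] \in p.
    by apply: ps => i; rewrite (cP i).2; apply: eq_bigr => j _; rewrite mxE.
  have [K [f fP]] := residue_field p.
  have A0 : map_mx f A = 0.
    by apply/matrixP => i j; rewrite !mxE; apply/eqP; rewrite -fP (cP i).1.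
  move: ps; rewrite fP -horner_map map_char_poly A0 /char_poly /char_poly_mx.
  rewrite map_mx0 subr0 det_scalar hornerXn expf_eq0 -fP (negPf sp).
  by rewrite andbF.
have [||q [qN qE]] := prime_avoiding idN _ _ disN.
- by exists 1; rewrite ?rmorph1 // idealr1.
- move=> _ _ [s sp ->] [r rp ->]; exists (s * r); last by rewrite rmorphM.
  by rewrite prime_idealrM negb_or sp.
exists q => x; apply/idP/idP => [xp|].
  by apply: qN; rewrite -[u x]mulr1; apply: Ng.
by apply: contraLR => xp; apply: qE; exists x.
Qed.

(** A non-nilpotent x avoids some prime of R; that prime is contracted from S, where the nilpotent
    u(x) lies in every prime. *)
Lemma cover_nilpotent (R S : comNzRingType) (u : {rmorphism R -> S}) x :
  finite_cover u -> nilpotent (u x) -> nilpotent x.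
Proof.
move=> [_ us] ux; apply: contrapT => /exists_prime[p].
by have [q ->] := us p; rewrite nilpotent_prime.
Qed.

Lemma finite_cover_inj (R S : comNzRingType) (u : {rmorphism R -> S}) :
  finite_hom u -> (forall x, u x = 0 -> nilpotent x) -> finite_cover u.
Proof. by move=> uf ker; split; last exact: lying_over. Qed.

Section Functional.
Variables (S T : comNzRingType) (u : {rmorphism S -> T}) (p : prime_idealr T).
Variables (K : fieldType) (f : {rmorphism S -> K}).
Hypothesis fP : forall s, (f s == 0) = (u s \in p).

(* A maximal S-submodule of T that contains p and meets S in a part of the
   kernel of f has rank one quotient: it is the kernel of the functional. *)
Lemma residue_functional : exists h : {additive T -> K},
  h 1 = 1 /\ forall s t, h (u s * t) = f s * h t.
Proof.
have [||N [subN sN disN maxN]] := @max_submodule S T u (fun x => x \in p)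
    (fun x => exists2 s, f s != 0 & x = u s).
- split=> [|x y|s x]; [exact: idealr0 | exact: rpredD | exact: idealMr].
- by move=> x xp [s sp e]; move: sp; rewrite fP -e xp.
have NB := submoduleB subN; have [N0 ND NZ] := subN.
(* A pair (s, r) says that t is congruent to r/s modulo [N], so the functional should take the value
   f(r)/f(s) at t. *)
pose val t (sr : S * S) := f sr.1 != 0 /\ N (u sr.1 * t - u sr.2).
have ex_val t : exists sr, val t sr.
  have [Nt|/maxN[n Nn [s [r r0 e]]]] := pselect (N t).
    exists (1, 0); split=> /=; first by rewrite rmorph1 oner_neq0.
    by rewrite rmorph1 mul1r rmorph0 subr0.
  have e' : u s * t - u r = - n by rewrite -e opprD addrC subrK.
  exists (s, r); split=> /=; last by rewrite e'; apply: submoduleN subN Nn.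
  (* The denominator survives: if f(s) = 0, then u(s) lies in p, and u(r) = n + u(s)t would be an
     element of [N] with f(r) nonzero. *)
  apply: contraT; rewrite negbK fP => sp; case: (disN (u r)); last by exists r.
  by rewrite -e; apply: ND => //; apply: sN; rewrite mulrC idealMr.
have val_inj t a b : val t a -> val t b -> f a.2 / f a.1 = f b.2 / f b.1.
  move=> [a0 Na] [b0 Nb]; apply/eqP; rewrite eqr_div // -!rmorphM -subr_eq0.
  rewrite -rmorphB; apply: contraT => nz.
  case: (disN (u (a.2 * b.1 - b.2 * a.1))); last by exists (a.2 * b.1 - b.2 * a.1).
  rewrite (_ : u _ = u a.1 * (u b.1 * t - u b.2) - u b.1 * (u a.1 * t - u a.2)).
    by apply: NB; apply: NZ.
  by ring.
have [v vP] := choice ex_val.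
pose h t := f (v t).2 / f (v t).1.
have hE t sr : val t sr -> h t = f sr.2 / f sr.1 by apply: val_inj.
have [|H HE] := @additive_of T K h.
  move=> x y; have [[x0 Nx] [y0 Ny]] := (vP x, vP y).
  rewrite (@hE _ ((v x).1 * (v y).1, (v x).2 * (v y).1 - (v y).2 * (v x).1)).
    rewrite /= rmorphB !rmorphM mulrBl /h invfM.
    by rewrite mulrACA mulfV // mulr1 [_^-1 * _]mulrC mulrACA mulfV // mulr1.
  split=> /=; first by rewrite rmorphM mulf_neq0.
  have /NB -/(_ _ (NZ (v x).1 _ Ny)) := NZ (v y).1 _ Nx.
  by congr N; ring.
exists H; rewrite HE; split=> [|s t].
  rewrite (@hE _ (1, 1)) /= ?rmorph1 ?divr1 //; split=> /=.
    by rewrite rmorph1 oner_neq0.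
  by rewrite mulr1 subrr.
rewrite !HE (@hE _ ((v t).1, s * (v t).2)) /=.
  by rewrite rmorphM mulrA.
have [t0 Nt] := vP t; split=> //=.
by rewrite rmorphM mulrCA -mulrBr; apply: NZ.
Qed.

End Functional.

Section BaseChange.
Variables (S V T : comNzRingType).
Variables (k : {rmorphism S -> V}) (u : {rmorphism S -> T}).
Hypothesis uc : finite_cover u.

(** For a prime q of V with f from V to a field K, take a prime of T over the contraction of q to S
    and the S-linear functional l on T that it provides. Then v (x) t |-> f(v) l(t) is a V-linear
    functional h with h(1) = 1. It shows that the tensor product is not zero and produces a prime
    over q. *)
Lemma cover_base_change :
  exists (W : comNzRingType) (i : {rmorphism V -> W}) (j : {rmorphism T -> W}),
    is_tensor k u i j /\ finite_cover i.
Proof.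
have [P [i [j [ijP gen]]]] := tensor_product k u; have [comm univ] := ijP.
have fun_at (q : prime_idealr V) : exists (K : fieldType)
      (f : {rmorphism V -> K}) (h : {additive P -> K}),
    [/\ forall v, (v \in q) = (f v == 0), h 1 = 1
      & forall v w, h (i v * w) = f v * h w].
  have [K [f fP]] := residue_field q.
  have [p pP] : exists p : prime_idealr S, forall s, (s \in p) = (k s \in q).
    have [|||p pP] := @prime_ideal_of S (fun s => k s \in q).
    - split=> [|x y|s x] /=; rewrite ?rmorph0 ?rmorphD ?rmorphM;
        [exact: idealr0 | exact: rpredD | exact: idealMr].
    - by rewrite rmorph1 idealr1.
    - by move=> x y; rewrite rmorphM prime_idealrM => /orP.
    by exists p => s; apply/idP/idP => /pP.
  have [r rP] := uc.2 p.
  have [l [l1 lM]] : exists l : {additive T -> K},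
      l 1 = 1 /\ forall s t, l (u s * t) = (f \o k) s * l t.
    apply: (@residue_functional _ _ u r) => s /=.
    by rewrite -fP -pP rP.
  have [|||h [hE _]] := univ K (fun x y => f x * l y).
  - by move=> x y z; rewrite raddfB mulrBr.
  - by move=> x y z; rewrite rmorphB mulrBl.
  - by move=> x y s; rewrite rmorphM lM -mulrA.
  exists K, f, h; split=> [//||v w].
    rewrite -[1](mulr1 1) -[X in X * _](rmorph1 i) -[X in _ * X](rmorph1 j).
    by rewrite hE rmorph1 mul1r.
  (* V-linearity comes from uniqueness: h(i(v) w) and f(v) h(w), as functions of w, extend the same
     balanced map. *)
  have [|||h' [_ h'u]] := univ K (fun x y => f (v * x) * l y).
  - by move=> x y z; rewrite raddfB mulrBr.
  - by move=> x y z; rewrite mulrBr rmorphB mulrBl.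
  - by move=> x y s; rewrite mulrA rmorphM lM -mulrA.
  have [|h1 h1E] := @additive_of P K (fun w => h (i v * w)).
    by move=> x y; rewrite mulrBr raddfB.
  have [|h2 h2E] := @additive_of P K (fun w => f v * h w).
    by move=> x y; rewrite raddfB mulrBr.
  rewrite -h1E -h2E h'u ?h'u // => x y.
    by rewrite h2E hE rmorphM mulrA.
  by rewrite h1E mulrA -rmorphM hE.
have nz : 1 != 0 :> P.
  have [|q _] := @exists_prime V 1.
    by case=> n /eqP; rewrite expr1n oner_eq0.
  have [K [f [h [_ h1 _]]]] := fun_at q.
  by apply: contra_eq_neq h1 => ->; rewrite raddf0 eq_sym oner_neq0.
pose mix := GRing.PzSemiRing_isNonZero.Build P nz.
pose W : comNzRingType := HB.pack (GRing.ComPzRing.sort P) mix.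
exists W, i, j; split=> //; split.
  have [n [g gP]] := uc.1; exists n, (j \o g) => w.
  have [s ->] := gen w; elim: s => [|[v t] s [c cE]].
    exists (fun=> 0); rewrite big_nil big1 // => l _; by rewrite rmorph0 mul0r.
  have [d ->] := gP t; exists (fun l => v * k (d l) + c l).
  rewrite big_cons cE rmorph_sum mulr_sumr -big_split; apply: eq_bigr => l _ /=.
  by rewrite rmorphD mulrDl !rmorphM -comm mulrA.
move=> q; have [K [f [h [fP h1 hM]]]] := fun_at q.
(* The largest ideal inside the kernel of h contains the image of q, and it misses i(v) for v
   outside q because h(i(v)) = f(v) is nonzero. *)
have [||||r [rN rE]] := @prime_avoiding W (fun w => forall w', h (w * w') = 0)
    (fun w => exists2 v, v \notin q & w = i v).
- split=> [w|w w' w0 w'0 x|x w w0 y] /=; first by rewrite mul0r raddf0.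
    by rewrite mulrDl raddfD w0 w'0 addr0.
  by rewrite -mulrA mulrCA w0.
- by exists 1; rewrite ?rmorph1 // idealr1.
- move=> _ _ [v vq ->] [v' vq' ->]; exists (v * v'); last by rewrite rmorphM.
  by rewrite prime_idealrM negb_or vq.
- move=> w w0 [v vq e]; move: (w0 1); rewrite e hM h1 mulr1 => /eqP.
  by rewrite -fP (negPf vq).
exists r => v; apply/idP/idP => [vq|].
  by apply: rN => w; rewrite hM; move: vq; rewrite fP => /eqP ->; rewrite mul0r.
by apply: contraLR => vq; apply: rE; exists v.
Qed.

End BaseChange.

(** * Presections of the finite site *)

(** The universal property yields only an additive map. Its uniqueness clause, isolated as [ext],
    gives multiplicativity in one factor at a time, pure tensors first. *)
Lemma tensor_rmorphism (S A B W C : comPzRingType) (alpha : {rmorphism S -> A})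
    (beta : {rmorphism S -> B}) (i : {rmorphism A -> W}) (j : {rmorphism B -> W})
    (a : {rmorphism A -> C}) (b : {rmorphism B -> C}) :
  is_tensor alpha beta i j -> (forall s, a (alpha s) = b (beta s)) ->
  exists c : {rmorphism W -> C}, (forall x, c (i x) = a x)
    /\ (forall y, c (j y) = b y).
Proof.
move=> [comm univ] ab.
have ext (f g : W -> C) : zmod_morphism f -> zmod_morphism g ->
    (forall x y, f (i x * j y) = g (i x * j y)) -> f =1 g.
  move=> /additive_of[F FE] /additive_of[G GE] fg w.
  have [|||h [_ hu]] := univ C (fun x y => F (i x * j y)).
  - by move=> x y z; rewrite rmorphB mulrBr raddfB.
  - by move=> x y z; rewrite rmorphB mulrBl raddfB.
  - by move=> x y s; rewrite !rmorphM comm mulrA.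
  by rewrite -FE -GE !hu // => x y; rewrite FE fg GE.
have [|||h [hE _]] := univ C (fun x y => a x * b y).
- by move=> x y z; rewrite rmorphB mulrBr.
- by move=> x y z; rewrite rmorphB mulrBl.
- by move=> x y s; rewrite !rmorphM ab mulrA.
have h1 : h 1 = 1.
  by rewrite -[1](mulr1 1) -{1}(rmorph1 i) -(rmorph1 j) hE !rmorph1 mulr1.
have hM x y w : h (i x * j y * w) = h (i x * j y) * h w.
  apply: (ext (fun w => h (i x * j y * w)) (fun w => h (i x * j y) * h w)).
  - by move=> z z'; rewrite mulrBr raddfB.
  - by move=> z z'; rewrite raddfB mulrBr.
  - by move=> x' y'; rewrite mulrACA -!rmorphM !hE !rmorphM mulrACA.
have {}hM : monoid_morphism h.
  split=> // z w; apply: (ext (fun z => h (z * w)) (fun z => h z * h w)) => //.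
  - by move=> x y; rewrite mulrBl raddfB.
  - by move=> x y; rewrite raddfB mulrBl.
have [|c cE] := @rmorphism_of W C h _ hM; first exact: raddfB.
exists c; split=> [x|y]; rewrite cE.
  by rewrite -[i x]mulr1 -(rmorph1 j) hE rmorph1 mulr1.
by rewrite -[j y]mul1r -(rmorph1 i) hE rmorph1 mul1r.
Qed.

Section Site.
Variable R : comNzRingType.
Implicit Types S T V W : fin_obj R.

Lemma fin_morE_comp S T V (v : fin_mor T V) (u : fin_mor S T) r :
  (v \o u) (fin_str S r) = fin_str V r.
Proof. by rewrite /= !fin_morE. Qed.

Lemma fin_morP_comp S T V (v : fin_mor T V) (u : fin_mor S T) :
  finite_hom (v \o u).
Proof. by apply: (finite_hom_comp (u := u) (v := v)); rewrite //; apply: fin_morP. Qed.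

Definition fin_comp S T V (v : fin_mor T V) (u : fin_mor S T) : fin_mor S V :=
  FinMor (fin_morE_comp v u) (fin_morP_comp v u).

Definition fin_id S : fin_mor S S :=
  @FinMor R S S idfun (fun _ => erefl) (finite_cover_id S).1.

Lemma fin_id_cover S : finite_cover (fin_id S).
Proof. exact: finite_cover_id. Qed.

Lemma fin_mor_of S T (f : {rmorphism fin_ring S -> fin_ring T}) :
  (forall r, f (fin_str S r) = fin_str T r) -> exists g : fin_mor S T, g =1 f.
Proof.
move=> fE; have ff : finite_hom f.
  apply: (finite_hom_right (u := fin_str S) (w := fin_str T)) => [r|].
    by rewrite /= fE.
  exact: (fin_objP T).1.
by exists (FinMor fE ff).
Qed.

Lemma fin_comp_cover S T V (v : fin_mor T V) (u : fin_mor S T) :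
  finite_cover u -> finite_cover v -> finite_cover (fin_comp v u).
Proof. exact: finite_cover_comp. Qed.

(** The target [C] ranges over all commutative rings, not only over objects of the site: the
    property is later applied to Q(R)^oo, to a quotient of K[X] and to an abstract tensor square. *)
Lemma fin_pushout S V T (k : fin_mor S V) (u : fin_mor S T) :
  finite_cover u ->
  exists (W : fin_obj R) (v : fin_mor V W) (w : fin_mor T W),
    [/\ finite_cover v, forall s, v (k s) = w (u s)
      & forall (C : comPzRingType) (a : {rmorphism fin_ring V -> C})
          (b : {rmorphism fin_ring T -> C}), (forall s, a (k s) = b (u s)) ->
        exists c : {rmorphism fin_ring W -> C},
          (forall x, c (v x) = a x) /\ (forall y, c (w y) = b y)].
Proof.
move=> uc; have [A [i [j [ijP ic]]]] := cover_base_change k uc.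
pose str : {rmorphism R -> A} := i \o fin_str V.
have sc : finite_cover str by apply: (finite_cover_comp _ (fin_objP V) ic).
pose W := FinObj sc.
have [|w wE] := @fin_mor_of T W j.
  by move=> r; rewrite -(fin_morE u) -ijP.1 fin_morE.
exists W, (@FinMor R V W i (fun=> erefl) ic.1), w; split=> // [s|C a b ab].
  by rewrite wE /= ijP.1.
have [c [ca cb]] := tensor_rmorphism ijP ab.
by exists c; split=> // y; rewrite wE.
Qed.

Definition weakly_matching S T (u : fin_mor S T) (t : T) : Prop :=
  forall V (g h : fin_mor T V), g \o u =1 h \o u -> nilpotent (g t - h t).

Record presection S := Presection {
  ps_obj : fin_obj R;
  ps_mor : fin_mor S ps_obj;
  ps_cover : finite_cover ps_mor;
  ps_val : ps_obj;
  ps_matching : weakly_matching ps_mor ps_val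
}.

(* In the sheaf, the section represented by x restricts to that of y. *)
Definition restricts S S' (k : S -> S') (x : presection S) (y : presection S') :
    Prop :=
  forall V (g : fin_mor (ps_obj x) V) (h : fin_mor (ps_obj y) V),
    (forall s, g (ps_mor x s) = h (ps_mor y (k s))) ->
    nilpotent (g (ps_val x) - h (ps_val y)).

Section Push.
Variables (S S' T W : fin_obj R) (k : fin_mor S S') (u : fin_mor S T).
Variables (v : fin_mor S' W) (w : fin_mor T W).
Hypothesis vw : forall s, v (k s) = w (u s).

Lemma matching_push t : weakly_matching u t -> weakly_matching v (w t).
Proof.
move=> tm V g h gh; apply: (tm V (fin_comp g w) (fin_comp h w)) => s /=.
by rewrite -vw; apply: gh.
Qed.

Lemma restricts_push (uc : finite_cover u) (vc : finite_cover v) t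
    (m : weakly_matching u t) :
  restricts k (Presection uc m) (Presection vc (matching_push m)).
Proof.
move=> V g h /= gh.
by apply: (m V g (fin_comp h w)) => s /=; rewrite gh vw.
Qed.

End Push.

Lemma restricts_exists S S' (k : fin_mor S S') (x : presection S) :
  exists (y : presection S') (w : fin_mor (ps_obj x) (ps_obj y)),
    [/\ forall s, w (ps_mor x s) = ps_mor y (k s), ps_val y = w (ps_val x)
      & restricts k x y].
Proof.
case: x => T u uc t tm; have [W [v [w [vc vw _]]]] := fin_pushout k uc.
exists (Presection vc (matching_push vw tm)), w; split=> //.
exact: restricts_push.
Qed.

(** The target V need not receive the cover that carries y. It does after base change along that
    cover, where both hypotheses apply, and nilpotency descends back to V. *)
Lemma restricts_trans S S' S'' (k : fin_mor S S') (k' : fin_mor S' S'')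
    (l : S -> S'') x y z :
  l =1 k' \o k -> restricts k x y -> restricts k' y z -> restricts l x z.
Proof.
move=> lE xy yz V g h gh.
have [W [v [w [vc vw _]]]] :=
  fin_pushout (fin_comp (fin_comp h (ps_mor z)) k') (ps_cover y).
apply: (cover_nilpotent vc); rewrite rmorphB.
apply: (@nilpotent_trans _ (w (ps_val y))).
  apply: (xy W (fin_comp v g)) => s /=.
  by rewrite gh lE -vw.
by apply: (yz W w (fin_comp v h)) => s /=; rewrite -vw.
Qed.

Definition coincide S := restricts (@id S).

Lemma restricts_inj S S' (k : fin_mor S S') x y y' :
  restricts k x y -> restricts k x y' -> coincide y y'.
Proof.
move=> xy xy' V g h gh.
have [W [v [w [vc vw _]]]] :=
  fin_pushout (fin_comp (fin_comp g (ps_mor y)) k) (ps_cover x).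
apply: (cover_nilpotent vc); rewrite rmorphB.
apply: (@nilpotent_trans _ (w (ps_val x))).
  apply: nilpotentBC; apply: (xy W w (fin_comp v g)) => s /=.
  by rewrite -vw.
by apply: (xy' W w (fin_comp v h)) => s /=; rewrite -vw /= gh.
Qed.

Lemma coincide_sym S (x y : presection S) : coincide x y -> coincide y x.
Proof.
by move=> xy V g h gh; apply: nilpotentBC; apply: xy => s; rewrite gh.
Qed.

Lemma coincide_trans S (y x z : presection S) :
  coincide x y -> coincide y z -> coincide x z.
Proof. by apply: (@restricts_trans S S S (fin_id S) (fin_id S)). Qed.

Lemma common_cover S (x y : presection S) :
  exists V (g : fin_mor (ps_obj x) V) (h : fin_mor (ps_obj y) V),
    finite_cover (fin_comp g (ps_mor x))
    /\ forall s, g (ps_mor x s) = h (ps_mor y s).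
Proof.
have [W [v [w [vc vw _]]]] := fin_pushout (ps_mor x) (ps_cover y).
by exists W, v, w; split=> //; apply: fin_comp_cover => //; apply: ps_cover.
Qed.

(** One common cover suffices to compare x and y, although [coincide] quantifies over all targets:
    base change another target along it, and use weak matching of x and of y to move between the two
    pairs of maps. *)
Lemma coincideI S (x y : presection S) V (g : fin_mor (ps_obj x) V)
    (h : fin_mor (ps_obj y) V) :
  finite_cover (fin_comp g (ps_mor x)) ->
  (forall s, g (ps_mor x s) = h (ps_mor y s)) ->
  nilpotent (g (ps_val x) - h (ps_val y)) -> coincide x y.
Proof.
move=> gc gh xy V' g' h' gh'.
have [W [v [w [vc vw _]]]] := fin_pushout (fin_comp g' (ps_mor x)) gc.
apply: (cover_nilpotent vc); rewrite rmorphB.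
apply: (@nilpotent_trans _ (w (g (ps_val x)))).
  by apply: (ps_matching (g := fin_comp v g') (h := fin_comp w g)) => s /=; rewrite -vw.
apply: (@nilpotent_trans _ (w (h (ps_val y)))).
  by rewrite -rmorphB; apply: nilpotent_rmorph.
apply: (ps_matching (g := fin_comp w h) (h := fin_comp v h')) => s /=.
by rewrite -gh -gh' -vw.
Qed.

Lemma push_matching S (x : presection S) T (f : fin_mor (ps_obj x) T) :
  weakly_matching (fin_comp f (ps_mor x)) (f (ps_val x)).
Proof.
move=> V g h gh.
by apply: (ps_matching (g := fin_comp g f) (h := fin_comp h f)) => s; apply: gh.
Qed.

Definition push_presection S (x : presection S) T (f : fin_mor (ps_obj x) T)
    (fc : finite_cover (fin_comp f (ps_mor x))) : presection S :=
  Presection fc (push_matching (f := f)).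

Lemma coincide_push S (x : presection S) T (f : fin_mor (ps_obj x) T)
    (fc : finite_cover (fin_comp f (ps_mor x))) :
  coincide x (push_presection fc).
Proof.
apply: (@coincideI S x (push_presection fc) T f (fin_id T)) => //=.
by rewrite subrr; apply: nilpotent0.
Qed.

Section Descent.
Variables (S : fin_obj R) (x : presection S).
Variables (T : fin_obj R) (u : fin_mor S T) (j : fin_mor T (ps_obj x)) (t : T).
Hypothesis uc : finite_cover u.
Hypothesis ju : forall s, j (u s) = ps_mor x s.
Hypothesis jt : j t = ps_val x.
Hypothesis jker : forall y, j y = 0 -> nilpotent y.

(* Two morphisms out of T need not extend to the cover of x, but they do after
   base change of their target, once for each of them. *)
Lemma descent_matching : weakly_matching u t.
Proof.
have jc : finite_cover j by apply: finite_cover_inj jker; apply: fin_morP.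
move=> V g h gh.
have [V1 [v1 [w1 [v1c vw1 _]]]] := fin_pushout g jc.
have [V2 [v2 [w2 [v2c vw2 _]]]] := fin_pushout (fin_comp v1 h) jc.
apply: (cover_nilpotent v1c); apply: (cover_nilpotent v2c).
rewrite !rmorphB vw1 jt -[v2 (v1 (h t))]/(v2 (fin_comp v1 h t)) vw2 jt.
apply: (ps_matching (g := fin_comp v2 w1) (h := w2)) => s /=.
rewrite -ju -vw1 -vw2 /=; congr (v2 (v1 _)); exact: gh.
Qed.

Lemma coincide_descent : coincide (Presection uc descent_matching) x.
Proof.
apply: (@coincideI S (Presection uc descent_matching) x (ps_obj x) j (fin_id _)) => //=.
  apply: (fin_comp_cover (v := j)) => //.
  by apply: finite_cover_inj jker; apply: fin_morP.
by rewrite jt subrr; apply: nilpotent0.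
Qed.

End Descent.

Definition section_ideal S (x : presection S) (P : {poly S}) : Prop :=
  nilpotent (map_poly (ps_mor x) P).[ps_val x].

Lemma nilpotent_horner (A : comNzRingType) (P : {poly A}) x y :
  nilpotent (x - y) -> nilpotent (P.[x] - P.[y]).
Proof.
move=> xy; elim/poly_ind: P => [|P c IHP].
  by rewrite !horner0 subrr; apply: nilpotent0.
rewrite !hornerE; apply: nilpotentBD; last by rewrite subrr; apply: nilpotent0.
exact: nilpotentBM.
Qed.

Lemma section_ideal_coincide S (x y : presection S) P :
  coincide x y -> section_ideal x P -> section_ideal y P.
Proof.
move=> xy xP; have [W [v [w [vc vw _]]]] := fin_pushout (ps_mor y) (ps_cover x).
apply: (cover_nilpotent vc); rewrite -horner_map.
have -> : map_poly v (map_poly (ps_mor y) P) = map_poly w (map_poly (ps_mor x) P).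
  by rewrite -!map_poly_comp; apply: eq_map_poly => s; apply: vw.
have := nilpotent_rmorph w xP; rewrite -horner_map => xP'.
rewrite -[X in nilpotent X](subrK (map_poly w (map_poly (ps_mor x) P)).[w (ps_val x)]).
apply: nilpotentD => //; apply: nilpotent_horner.
by apply: nilpotentBC; apply: xy => s; rewrite vw.
Qed.

(** Dividing by the nilradical is a finite cover, since the kernel is nil. On a reduced
    representative, [section_ideal] becomes the kernel of evaluation. *)
Lemma reduced_presection S (x : presection S) :
  exists2 y : presection S, coincide x y & forall z : ps_obj y, nilpotent z -> z = 0.
Proof.
have [||Q [pi [pis pi0]]] := @quotient_ring (ps_obj x) (@nilpotent _).
- split; [exact: nilpotent0 | exact: nilpotentD | move=> *; exact: nilpotentMl].
- by case=> n /eqP; rewrite expr1n oner_eq0.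
have pic : finite_cover pi.
  by apply: finite_cover_inj => [|z /pi0 //]; apply: finite_hom_surj.
have strc : finite_cover (pi \o fin_str (ps_obj x)).
  exact: (finite_cover_comp _ (fin_objP _) pic).
pose f : fin_mor (ps_obj x) (FinObj strc) :=
  @FinMor R _ (FinObj strc) pi (fun=> erefl) pic.1.
have fc : finite_cover (fin_comp f (ps_mor x)).
  by apply: fin_comp_cover => //; apply: ps_cover.
exists (push_presection fc); first exact: coincide_push.
move=> z; have [{}z <-] := pis z; case=> n.
by rewrite -rmorphXn => /pi0/nilpotentX/pi0.
Qed.

Definition eval_at (A B : comNzRingType) (u : {rmorphism A -> B}) (t : B) :
    {rmorphism {poly A} -> B} := horner_eval t \o map_poly u.

(** The ring S[t] is built as a quotient of S[X], so that it depends on the kernel of evaluation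
    alone; this lets two presections share it. *)
Lemma monogenic S (A : comNzRingType) (u : {rmorphism fin_ring S -> A}) (t : A) :
  finite_cover u ->
  exists (T : fin_obj R) (s : fin_mor S T) (e : {rmorphism {poly S} -> T}),
    [/\ finite_cover s, forall a, e a%:P = s a, forall y, exists P, e P = y
      & forall P, e P = 0 <-> (map_poly u P).[t] = 0].
Proof.
move=> uc.
have [||Q [e [es e0]]] := @quotient_ring {poly S} (fun P => eval_at u t P = 0).
- split=> [|P Q P0 Q0|P Q Q0]; first exact: rmorph0.
    by rewrite rmorphD P0 Q0 addr0.
  by rewrite rmorphM Q0 mulr0.
- by rewrite rmorph1; apply/eqP/oner_neq0.
pose s : {rmorphism S -> Q} := e \o polyC.
have sf : finite_hom s.
  have [p pm p0] := finite_hom_integral t uc.1.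
  (* Remainders modulo the monic equation [p] of t have size below [size p], so these powers of X
     generate. *)
  exists (size p), (fun i => e 'X^i) => y; have [P <-] := es y.
  exists (fun i => (Pdiv.Ring.rmodp P p)`_i).
  rewrite [in LHS](Pdiv.RingMonic.rdivp_eq pm P) rmorphD rmorphM.
  rewrite ((e0 p).2 p0) mulr0 add0r.
  set r := Pdiv.Ring.rmodp P p.
  have szr : (size r <= size p)%N.
    by rewrite ltnW // Pdiv.Ring.ltn_rmodpN0 // monic_neq0.
  rewrite -[in LHS](_ : \poly_(i < size p) r`_i = r); last first.
    apply/polyP => i; rewrite coef_poly; case: ltnP => // /(leq_trans szr) ri.
    by rewrite nth_default.
  rewrite poly_def rmorph_sum; apply: eq_bigr => i _.
  by rewrite -mul_polyC rmorphM.
have sc : finite_cover s.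
  apply: finite_cover_inj => // a /e0 /=.
  rewrite /horner_eval map_polyC hornerC => ua0; apply: (cover_nilpotent uc).
  by rewrite ua0; apply: nilpotent0.
have strc : finite_cover (s \o fin_str S).
  exact: (finite_cover_comp _ (fin_objP _) sc).
by exists (FinObj strc), (@FinMor R S (FinObj strc) s (fun=> erefl) sf), e.
Qed.

Lemma monogenic_coincide S (x : presection S) T (s : fin_mor S T)
    (sc : finite_cover s) (e : {rmorphism {poly S} -> T}) :
  (forall a, e a%:P = s a) -> (forall y, exists P, e P = y) ->
  (forall P, e P = 0 <-> (map_poly (ps_mor x) P).[ps_val x] = 0) ->
  exists em : weakly_matching s (e 'X), coincide (Presection sc em) x.
Proof.
move=> eC es e0.
have [|j0 j0E] := @factor_rmorphism _ _ _ e (eval_at (ps_mor x) (ps_val x)) es.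
  by move=> P /e0.
have j0s a : j0 (s a) = ps_mor x a.
  by rewrite -eC j0E /= /horner_eval map_polyC hornerC.
have [r|j jE] := @fin_mor_of T (ps_obj x) j0.
  by rewrite -(fin_morE s) j0s fin_morE.
have js a : j (s a) = ps_mor x a by rewrite jE.
have jX : j (e 'X) = ps_val x by rewrite jE j0E /= /horner_eval map_polyX hornerX.
have jker y : j y = 0 -> nilpotent y.
  have [P <-] := es y; rewrite jE j0E => /e0 ->; exact: nilpotent0.
exists (descent_matching js jX jker); exact: coincide_descent.
Qed.

(** The ideal determines the class: once the representatives are reduced, it is the kernel of
    evaluation at the value, and the class of X in S[X] modulo this kernel is again a
    representative. *)
Lemma coincideP S (x y : presection S) :
  coincide x y <-> section_ideal x = section_ideal y.
Proof.
have idealE (z z' : presection S) :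
    coincide z z' -> forall P, section_ideal z P <-> section_ideal z' P.
  by move=> zz' P; split; apply: section_ideal_coincide; last exact: coincide_sym.
split=> [xy|xy]; first by rewrite predeqE; apply: idealE.
have [x' xx' redx] := reduced_presection x.
have [y' yy' redy] := reduced_presection y.
have [T [s [e [sc eC es e0]]]] := monogenic (ps_val x') (ps_cover x').
have [//|em ex'] := @monogenic_coincide S x' T s sc e eC es.
(* The ring [T] built from x' also represents y', because equal ideals on reduced covers mean equal
   kernels. *)
have [P|em' ey'] := @monogenic_coincide S y' T s sc e eC es.
  rewrite e0; have idP : section_ideal x' P <-> section_ideal y' P.
    by rewrite -(idealE _ _ xx') -(idealE _ _ yy') xy.
  split=> P0; [apply: redy; apply/idP | apply: redx; apply/idP];
    rewrite /section_ideal P0; exact: nilpotent0.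
apply: (coincide_trans xx'); apply: (coincide_trans _ (coincide_sym yy')).
apply: (coincide_trans (coincide_sym ex')).
by rewrite (Prop_irrelevance em em').
Qed.

End Site.

(** * The sheaf of sections *)

Section Matching.
Variable R : comNzRingType.
Implicit Types S T V W : fin_obj R.

Section Closed.
Variables (S T : fin_obj R) (u : fin_mor S T).
Implicit Types t : T.

Lemma matchingD t t' : weakly_matching u t -> weakly_matching u t' ->
  weakly_matching u (t + t').
Proof.
move=> m m' V g h gh; rewrite !rmorphD.
by apply: nilpotentBD; [apply: m | apply: m'].
Qed.

Lemma matchingM t t' : weakly_matching u t -> weakly_matching u t' ->
  weakly_matching u (t * t').
Proof.
move=> m m' V g h gh; rewrite !rmorphM.
by apply: nilpotentBM; [apply: m | apply: m'].
Qed.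

Lemma matching_str s : weakly_matching u (u s).
Proof. by move=> V g h /(_ s) /= ->; rewrite subrr; apply: nilpotent0. Qed.

End Closed.

(* The presections over S do not fit in the universe of the rings, so a section
   is encoded by the ideal of the polynomials over S that are nilpotent at a
   representative: it cuts out the graph of the section in the affine line. *)
Definition fin_section S :=
  {J : {poly S} -> Prop | exists x : presection S, J = section_ideal x}.

HB.instance Definition _ S := gen_eqMixin (fin_section S).
HB.instance Definition _ S := gen_choiceMixin (fin_section S).

Definition fin_class S (x : presection S) : fin_section S :=
  exist _ (section_ideal x) (ex_intro _ x erefl).

Lemma fin_class_surj S (f : fin_section S) : exists x, f = fin_class x.
Proof. by case: f => J [x Jx]; exists x; exact: eq_exist. Qed.

Lemma fin_classP S (x y : presection S) :
  fin_class x = fin_class y <-> coincide x y.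
Proof.
rewrite coincideP; split=> [[]//|xy]; exact: eq_exist.
Qed.

Section Operations.
Variable S : fin_obj R.
Implicit Types f g h : fin_section S.

Lemma common_presection3 f g h :
  exists (T : fin_obj R) (u : fin_mor S T) (uc : finite_cover u) (a b c : T)
    (am : weakly_matching u a) (bm : weakly_matching u b)
    (cm : weakly_matching u c),
    [/\ f = fin_class (Presection uc am), g = fin_class (Presection uc bm)
      & h = fin_class (Presection uc cm)].
Proof.
have [[x ->] [[y ->] [z ->]]] :=
  (fin_class_surj f, (fin_class_surj g, fin_class_surj h)).
have [V [p [q [pc pq]]]] := common_cover x y.
have [W [v [w [vc vw _]]]] := fin_pushout (fin_comp p (ps_mor x)) (ps_cover z).
have uc := fin_comp_cover pc vc.
set u := fin_comp v _ in uc.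
have xm : weakly_matching u (v (p (ps_val x))).
  exact: (push_matching (x := x) (f := fin_comp v p)).
have ym : weakly_matching u (v (q (ps_val y))).
  move=> V' i j ij; apply: (ps_matching (g := fin_comp i (fin_comp v q))
    (h := fin_comp j (fin_comp v q))) => s /=.
  by rewrite -pq; apply: ij.
have zm : weakly_matching u (w (ps_val z)).
  move=> V' i j ij; apply: (ps_matching (g := fin_comp i w) (h := fin_comp j w)).
  by move=> s /=; rewrite -vw; apply: ij.
have e0 := @nilpotent0 W.
exists W, u, uc, _, _, _, xm, ym, zm; split; apply/fin_classP.
- by apply: (@coincideI _ S _ (Presection uc xm) W (fin_comp v p) (fin_id W));
    rewrite //= subrr.
- apply: (@coincideI _ S _ (Presection uc ym) W (fin_comp v q) (fin_id W)).
  + by apply: finite_cover_ext uc => s /=; rewrite pq.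
  + by move=> s /=; rewrite pq.
  + by rewrite /= subrr.
- apply: (@coincideI _ S _ (Presection uc zm) W w (fin_id W)).
  + by apply: finite_cover_ext uc => s /=; rewrite -vw.
  + by move=> s /=; rewrite -vw.
  + by rewrite /= subrr.
Qed.

Lemma common_presection f g :
  exists (T : fin_obj R) (u : fin_mor S T) (uc : finite_cover u) (a b : T)
    (am : weakly_matching u a) (bm : weakly_matching u b),
    f = fin_class (Presection uc am) /\ g = fin_class (Presection uc bm).
Proof.
have [T [u [uc [a [b [_ [am [bm [_ [fE gE _]]]]]]]]]] := common_presection3 f g g.
by exists T, u, uc, a, b, am, bm.
Qed.

Lemma eq_fin_class (T : fin_obj R) (u : fin_mor S T) (uc : finite_cover u)
    (a b : T) (am : weakly_matching u a) (bm : weakly_matching u b) :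
  a = b -> fin_class (Presection uc am) = fin_class (Presection uc bm).
Proof. by move=> ab; subst b; rewrite (Prop_irrelevance am bm). Qed.

(** No common cover is canonical, so the sum is extracted from this statement by choice; [sec_addE]
    shows that every common cover computes the same sum. *)
Lemma add_graph f g : exists r, exists (T : fin_obj R) (u : fin_mor S T)
    (uc : finite_cover u) (a b : T) (am : weakly_matching u a)
    (bm : weakly_matching u b),
  [/\ f = fin_class (Presection uc am), g = fin_class (Presection uc bm)
    & r = fin_class (Presection uc (matchingD am bm))].
Proof.
have [T [u [uc [a [b [am [bm [fE gE]]]]]]]] := common_presection f g.
by eexists; exists T, u, uc, a, b, am, bm.
Qed.

Lemma mul_graph f g : exists r, exists (T : fin_obj R) (u : fin_mor S T)
    (uc : finite_cover u) (a b : T) (am : weakly_matching u a)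
    (bm : weakly_matching u b),
  [/\ f = fin_class (Presection uc am), g = fin_class (Presection uc bm)
    & r = fin_class (Presection uc (matchingM am bm))].
Proof.
have [T [u [uc [a [b [am [bm [fE gE]]]]]]]] := common_presection f g.
by eexists; exists T, u, uc, a, b, am, bm.
Qed.

Definition sec_add f g : fin_section S := projT1 (cid (add_graph f g)).
Definition sec_mul f g : fin_section S := projT1 (cid (mul_graph f g)).
Definition sec_const (s : S) : fin_section S :=
  fin_class (Presection (fin_id_cover S) (matching_str (u := fin_id S) s)).
(** As a product with a constant, the opposite inherits independence of representatives from
    multiplication. *)
Definition sec_opp f : fin_section S := sec_mul (sec_const (-1)) f.

Section OnCover.
Variables (T : fin_obj R) (u : fin_mor S T) (uc : finite_cover u).
Variables (a b : T) (am : weakly_matching u a) (bm : weakly_matching u b).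

Lemma sec_addE :
  sec_add (fin_class (Presection uc am)) (fin_class (Presection uc bm)) =
  fin_class (Presection uc (matchingD am bm)).
Proof.
rewrite /sec_add; case: cid => _ /= [T' [u' [uc' [a' [b' [am' [bm' [+ + ->]]]]]]]].
move=> /fin_classP aa' /fin_classP bb'; apply/fin_classP => V g h gh /=.
rewrite !rmorphD; apply: nilpotentBD; apply: nilpotentBC.
  by apply: aa' => s; rewrite gh.
by apply: bb' => s; rewrite gh.
Qed.

Lemma sec_mulE :
  sec_mul (fin_class (Presection uc am)) (fin_class (Presection uc bm)) =
  fin_class (Presection uc (matchingM am bm)).
Proof.
rewrite /sec_mul; case: cid => _ /= [T' [u' [uc' [a' [b' [am' [bm' [+ + ->]]]]]]]].
move=> /fin_classP aa' /fin_classP bb'; apply/fin_classP => V g h gh /=.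
rewrite !rmorphM; apply: nilpotentBM; apply: nilpotentBC.
  by apply: aa' => s; rewrite gh.
by apply: bb' => s; rewrite gh.
Qed.

Lemma sec_constE (s : S) :
  sec_const s = fin_class (Presection uc (matching_str (u := u) s)).
Proof.
by apply/fin_classP => V g h /(_ s) /= ->; rewrite subrr; apply: nilpotent0.
Qed.

End OnCover.

Lemma sec_addA : associative sec_add.
Proof.
move=> f g h.
have [T [u [uc [a [b [c [am [bm [cm [-> -> ->]]]]]]]]]] := common_presection3 f g h.
by rewrite !sec_addE; apply: eq_fin_class; rewrite addrA.
Qed.

Lemma sec_addC : commutative sec_add.
Proof.
move=> f g; have [T [u [uc [a [b [am [bm [-> ->]]]]]]]] := common_presection f g.
by rewrite !sec_addE; apply: eq_fin_class; rewrite addrC.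
Qed.

Lemma sec_add0 : left_id (sec_const 0) sec_add.
Proof.
move=> f; have [[T u uc a am] ->] := fin_class_surj f.
by rewrite (sec_constE uc) sec_addE; apply: eq_fin_class; rewrite rmorph0 add0r.
Qed.

Lemma sec_addN : left_inverse (sec_const 0) sec_opp sec_add.
Proof.
move=> f; have [[T u uc a am] ->] := fin_class_surj f.
rewrite /sec_opp !(sec_constE uc) sec_mulE sec_addE; apply: eq_fin_class.
by rewrite rmorphN1 mulN1r addNr rmorph0.
Qed.

HB.instance Definition _ := GRing.isZmodule.Build (fin_section S)
  sec_addA sec_addC sec_add0 sec_addN.

Lemma sec_mulA : associative sec_mul.
Proof.
move=> f g h.
have [T [u [uc [a [b [c [am [bm [cm [-> -> ->]]]]]]]]]] := common_presection3 f g h.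
by rewrite !sec_mulE; apply: eq_fin_class; rewrite mulrA.
Qed.

Lemma sec_mulC : commutative sec_mul.
Proof.
move=> f g; have [T [u [uc [a [b [am [bm [-> ->]]]]]]]] := common_presection f g.
by rewrite !sec_mulE; apply: eq_fin_class; rewrite mulrC.
Qed.

Lemma sec_mul1 : left_id (sec_const 1) sec_mul.
Proof.
move=> f; have [[T u uc a am] ->] := fin_class_surj f.
by rewrite (sec_constE uc) sec_mulE; apply: eq_fin_class; rewrite rmorph1 mul1r.
Qed.

Lemma sec_mulD : left_distributive sec_mul sec_add.
Proof.
move=> f g h.
have [T [u [uc [a [b [c [am [bm [cm [-> -> ->]]]]]]]]]] := common_presection3 f g h.
by rewrite !(sec_mulE, sec_addE); apply: eq_fin_class; rewrite mulrDl.
Qed.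

HB.instance Definition _ := GRing.Zmodule_isComPzRing.Build (fin_section S)
  sec_mulA sec_mulC sec_mul1 sec_mulD.

Section OnCoverRing.
Variables (T : fin_obj R) (u : fin_mor S T) (uc : finite_cover u).
Variables (a b : T) (am : weakly_matching u a) (bm : weakly_matching u b).

Lemma fin_classD : fin_class (Presection uc am) + fin_class (Presection uc bm) =
  fin_class (Presection uc (matchingD am bm)).
Proof. exact: sec_addE. Qed.

Lemma fin_classM : fin_class (Presection uc am) * fin_class (Presection uc bm) =
  fin_class (Presection uc (matchingM am bm)).
Proof. exact: sec_mulE. Qed.

Lemma fin_class1 : 1 = fin_class (Presection uc (matching_str (u := u) 1)).
Proof. exact: sec_constE. Qed.

End OnCoverRing.

Lemma fin_section_rmorphism (B : pzRingType) (F : fin_section S -> B) :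
  (forall (T : fin_obj R) (u : fin_mor S T) (uc : finite_cover u) (a b : T)
      (am : weakly_matching u a) (bm : weakly_matching u b),
    let f := fin_class (Presection uc am) in
    let g := fin_class (Presection uc bm) in
    F (f + g) = F f + F g /\ F (f * g) = F f * F g) ->
  F 1 = 1 -> exists G : {rmorphism fin_section S -> B}, G =1 F.
Proof.
move=> FDM F1; apply: rmorphism_of.
  have FD f g : F (f + g) = F f + F g.
    have [T [u [uc [a [b [am [bm [-> ->]]]]]]]] := common_presection f g.
    by case: (FDM T u uc a b am bm).
  by move=> f g; apply: (addIr (F g)); rewrite -FD !subrK.
split=> // f g; have [T [u [uc [a [b [am [bm [-> ->]]]]]]]] := common_presection f g.
by case: (FDM T u uc a b am bm).
Qed.

End Operations.

Lemma sec_const_rmorphism S :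
  exists c : {rmorphism S -> fin_section S}, c =1 @sec_const S.
Proof.
apply: rmorphism_of => [s t|].
  apply: (addIr (sec_const t)); rewrite subrK /sec_const fin_classD.
  by apply: eq_fin_class; rewrite /= subrK.
by split=> // s t; rewrite /sec_const fin_classM; apply: eq_fin_class.
Qed.

Definition sec_eta S : {rmorphism S -> fin_section S} :=
  projT1 (cid (sec_const_rmorphism S)).

Lemma sec_etaE S (T : fin_obj R) (u : fin_mor S T) (uc : finite_cover u) s :
  sec_eta S s = fin_class (Presection uc (matching_str (u := u) s)).
Proof. by rewrite /sec_eta; case: cid => c /= ->; apply: sec_constE. Qed.

Lemma sec_eta_eq S s t : nilpotent (s - t) <-> sec_eta S s = sec_eta S t.
Proof.
rewrite !(sec_etaE (fin_id_cover S)) fin_classP; split=> [st V g h gh /=|].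
  by rewrite (gh s) -rmorphB; apply: nilpotent_rmorph.
by move/(_ S (fin_id S) (fin_id S)); apply.
Qed.

Section Restriction.
Variables (S S' : fin_obj R) (k : fin_mor S S').

Lemma restriction_exists : exists r : {rmorphism fin_section S -> fin_section S'},
  forall x y, restricts k x y -> r (fin_class x) = fin_class y.
Proof.
have /choice[r rP] (f : fin_section S) : exists g : fin_section S',
    exists x y, [/\ restricts k x y, f = fin_class x & g = fin_class y].
  have [x ->] := fin_class_surj f.
  by have [y [_ [_ _ xy]]] := restricts_exists k x; exists (fin_class y), x, y.
have {}rP x y : restricts k x y -> r (fin_class x) = fin_class y.
  move=> xy; have [x' [y' [xy' /fin_classP xx' ->]]] := rP (fin_class x).
  apply/fin_classP/(restricts_inj xy').
  by apply: (restricts_trans (k := fin_id S) _ (coincide_sym xx') xy).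
have [T u uc a b am bm f g||r' r'E] := @fin_section_rmorphism S _ r.
- have [W [v [w [vc vw _]]]] := fin_pushout k uc.
  rewrite /f /g fin_classD fin_classM
    !(rP _ _ (@restricts_push _ _ _ _ _ k u v w vw uc vc _ _)).
  rewrite fin_classD fin_classM.
  by split; apply: eq_fin_class; rewrite ?rmorphD ?rmorphM.
- rewrite (fin_class1 (fin_id_cover S)) (fin_class1 (fin_id_cover S')); apply: rP.
  by move=> V g h /(_ 1) /=; rewrite !rmorph1 => _; rewrite subrr; apply: nilpotent0.
by exists r' => x y xy; rewrite r'E; apply: rP.
Qed.

Definition restriction : {rmorphism fin_section S -> fin_section S'} :=
  projT1 (cid restriction_exists).

Lemma restrictionE x y :
  restricts k x y -> restriction (fin_class x) = fin_class y.
Proof. by rewrite /restriction; case: cid => r /= rP /rP. Qed.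

Lemma restrictionP x y :
  restriction (fin_class x) = fin_class y -> restricts k x y.
Proof.
have [z [_ [_ _ xz]]] := restricts_exists k x; rewrite (restrictionE xz).
move/fin_classP => zy; exact: (restricts_trans (k' := fin_id S') _ xz zy).
Qed.

End Restriction.

Lemma restriction_id S (u : fin_mor S S) : u =1 id -> restriction u =1 id.
Proof.
move=> uid f; have [x ->] := fin_class_surj f; apply: restrictionE.
by move=> V g h gh; apply: ps_matching => s /=; rewrite gh uid.
Qed.

Lemma restriction_comp S T V (u : fin_mor S T) (v : fin_mor T V)
    (w : fin_mor S V) :
  w =1 v \o u -> restriction w =1 restriction v \o restriction u.
Proof.
move=> wE f; have [x ->] := fin_class_surj f.
have [y [_ [_ _ xy]]] := restricts_exists u x.
have [z [_ [_ _ yz]]] := restricts_exists v y.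
rewrite /= (restrictionE xy) (restrictionE yz); apply: restrictionE.
exact: restricts_trans yz.
Qed.

Definition Fin : presheaf R :=
  @Presheaf R (fun S => fin_section S : comPzRingType)
    restriction restriction_id restriction_comp.

Lemma restriction_eta S T (u : fin_mor S T) s :
  sec_eta T (u s) = restriction u (sec_eta S s).
Proof.
rewrite !(sec_etaE (fin_id_cover _)); apply/esym/restrictionE.
by move=> V g h /(_ s) /= ->; rewrite subrr; apply: nilpotent0.
Qed.

Definition Fin_eta : psh_mor (structure_presheaf R) Fin :=
  @PshMor R (structure_presheaf R) Fin sec_eta restriction_eta.

(** Over the cover that carries it, a section becomes the image of an actual ring element. Gluing
    and the universal property both rest on this. *)
Lemma restriction_cover S (x : presection S) T (g : fin_mor (ps_obj x) T) :
  restriction (fin_comp g (ps_mor x)) (fin_class x) = sec_eta T (g (ps_val x)).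
Proof.
rewrite (sec_etaE (fin_id_cover T)); apply: restrictionE => V p q pq /=.
by apply: (ps_matching (g := p) (h := fin_comp q g)) => s; apply: pq.
Qed.

(** Covers compose, so a representative of f on a cover of T also lives on a cover of S. Over each
    test object [restriction_cover] turns matching of f into equality of images under [sec_eta],
    which by [sec_eta_eq] is weak matching of the representative. *)
Lemma Fin_sheaf : is_sheaf Fin.
Proof.
move=> S T u uc f fm; have [y fE] := fin_class_surj f.
have xm : weakly_matching (fin_comp (ps_mor y) u) (ps_val y).
  move=> V g h gh.
  have := fm V (fin_comp g (ps_mor y)) (fin_comp h (ps_mor y)) gh.
  by rewrite fE /= !restriction_cover => /sec_eta_eq.
exists (fin_class (Presection (fin_comp_cover uc (ps_cover y)) xm)); split.
  by rewrite fE; apply: restrictionE => V g h gh; apply: (xm) => s; apply: gh.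
move=> f'; have [z ->] := fin_class_surj f'; rewrite fE /= => /restrictionP zy.
apply/fin_classP => V g h /= gh.
have [W [v [w [vc vw _]]]] := fin_pushout (fin_comp g (fin_comp (ps_mor y) u)) uc.
have [W' [v' [w' [v'c vw' _]]]] := fin_pushout w (ps_cover y).
apply: (cover_nilpotent vc); apply: (cover_nilpotent v'c); rewrite !rmorphB.
apply: (@nilpotent_trans _ (w' (ps_val y))).
  apply: (xm W' (fin_comp v' (fin_comp v g)) w') => s /=.
  by rewrite -vw' -vw.
apply: nilpotentBC; apply: (zy W' (fin_comp v' (fin_comp v h)) w') => s /=.
by rewrite -gh -vw' -vw.
Qed.

End Matching.

(** * The universal property *)

Section Universal.
Variable R : comNzRingType.
Implicit Types S T V W : fin_obj R.

Lemma sheaf_inj (G : presheaf R) S T (u : fin_mor S T) :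
  is_sheaf G -> finite_cover u -> injective (psh_map G u).
Proof.
move=> Gsh uc a b ab.
have [|c [_ cu]] := Gsh S T u uc (psh_map G u b).
  move=> V g h gh.
  rewrite -[LHS](psh_comp (w := fin_comp g u)) //.
  by rewrite -[RHS](psh_comp (w := fin_comp g u)).
by rewrite -(cu b) // -(cu a).
Qed.

(** On a reduced cover of S the two elements become equal, and restriction along a cover is
    injective for a sheaf. The presection [x] only serves to obtain that cover. *)
Lemma sheaf_nilpotent (G : presheaf R) (phi : psh_mor (structure_presheaf R) G) S
    (a b : S) : is_sheaf G -> nilpotent (a - b) -> phi S a = phi S b.
Proof.
move=> Gsh ab; pose x := Presection (fin_id_cover S) (matching_str (u := fin_id S) a).
have [y _ red] := reduced_presection x.
apply: (sheaf_inj Gsh (ps_cover y)); rewrite -!psh_nat /=; congr (phi _ _).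
by apply/eqP; rewrite -subr_eq0 -rmorphB; apply/eqP/red/nilpotent_rmorph.
Qed.

Section Amalgamation.
Variables (G : presheaf R) (phi : psh_mor (structure_presheaf R) G).
Hypothesis Gsh : is_sheaf G.

Lemma amalgamation_uniq S (x y : presection S) s s' :
  psh_map G (ps_mor x) s = phi _ (ps_val x) ->
  psh_map G (ps_mor y) s' = phi _ (ps_val y) ->
  coincide x y -> s = s'.
Proof.
move=> xs ys xy; have [V [g [h [gc gh]]]] := common_cover x y.
apply: (sheaf_inj Gsh gc).
rewrite (psh_comp (u := ps_mor x) (v := g)) //=.
rewrite [RHS](psh_comp (u := ps_mor y) (v := h)) //= xs ys -!psh_nat /=.
by apply: sheaf_nilpotent => //; apply: xy.
Qed.

(** By [sheaf_nilpotent] a weakly matching t gives a genuinely matching phi(t), which the sheaf [G]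
    glues to a section over S. *)
Lemma amalgamation_exists S : exists psi : {rmorphism fin_section S -> G S},
  forall x : presection S,
    psh_map G (ps_mor x) (psi (fin_class x)) = phi _ (ps_val x).
Proof.
have glue (x : presection S) : exists s, psh_map G (ps_mor x) s = phi _ (ps_val x).
  have [|s [sE _]] := Gsh (ps_cover x) (a := phi _ (ps_val x)); last by exists s.
  move=> V g h gh; rewrite -!psh_nat /=.
  by apply: sheaf_nilpotent => //; apply: ps_matching.
have /choice[psi psiP] (f : fin_section S) : exists s, exists2 x,
    f = fin_class x & psh_map G (ps_mor x) s = phi _ (ps_val x).
  by have [x ->] := fin_class_surj f; have [s sE] := glue x; exists s, x.
have psiE x s : psh_map G (ps_mor x) s = phi _ (ps_val x) -> psi (fin_class x) = s.
  move=> xs; have [y /fin_classP/coincide_sym yx ys] := psiP (fin_class x).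
  exact: amalgamation_uniq ys xs yx.
have psiK x : psh_map G (ps_mor x) (psi (fin_class x)) = phi _ (ps_val x).
  by have [s sE] := glue x; rewrite (psiE x s).
have [T u uc a b am bm f g||F FE] := @fin_section_rmorphism _ S _ psi.
- rewrite /f /g fin_classD fin_classM.
  have := psiK (Presection uc am); have := psiK (Presection uc bm) => /= pb pa.
  by split; apply: psiE; rewrite /= ?rmorphD ?rmorphM /= pa pb.
- by rewrite (fin_class1 (fin_id_cover S)); apply: psiE; rewrite /= !rmorph1.
by exists F => x; rewrite FE.
Qed.

Definition amalgamation S : {rmorphism fin_section S -> G S} :=
  projT1 (cid (amalgamation_exists S)).

Lemma amalgamationP S (x : presection S) :
  psh_map G (ps_mor x) (amalgamation S (fin_class x)) = phi _ (ps_val x).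
Proof. by rewrite /amalgamation; case: cid. Qed.

Lemma amalgamation_nat S T (u : fin_mor S T) (f : Fin R S) :
  amalgamation T (psh_map (Fin R) u f) = psh_map G u (amalgamation S f).
Proof.
have [x ->] := fin_class_surj f; have [y [w [uw yw xy]]] := restricts_exists u x.
rewrite [psh_map _ _ _](restrictionE xy).
apply: (sheaf_inj Gsh (ps_cover y)); rewrite amalgamationP.
rewrite -[RHS](psh_comp (w := fin_comp (ps_mor y) u)) //.
rewrite (psh_comp (u := ps_mor x) (v := w)) => [|s /=]; last by rewrite uw.
by rewrite /= amalgamationP -psh_nat /= yw.
Qed.

End Amalgamation.

(** Uniqueness of the factorization holds because each section lies in the image of [sec_eta] on its
    own cover, and [G] is separated. *)
Lemma Fin_sheafification : is_sheafification (Fin_eta R).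
Proof.
split=> [|G phi Gsh]; first exact: Fin_sheaf.
exists (PshMor (amalgamation_nat phi Gsh)); split=> [S a|psi' psi'E S f] /=.
  rewrite (sec_etaE (fin_id_cover S)).
  have := amalgamationP phi Gsh
    (Presection (fin_id_cover S) (matching_str (u := fin_id S) a)).
  by rewrite /= psh_id.
have [x ->] := fin_class_surj f; apply: (sheaf_inj Gsh (ps_cover x)).
rewrite amalgamationP -psi'E.
apply: etrans (esym (psh_nat psi' (ps_mor x) (fin_class x))) _.
congr (psi' _ _); rewrite -[RHS](restriction_cover (fin_id _)) /=.
rewrite [RHS](restriction_comp (u := ps_mor x) (v := fin_id _)) //.
exact/esym/(restriction_id (u := fin_id _)).
Qed.

Definition psh_mor_id (F : presheaf R) : psh_mor F F :=
  @PshMor R F F (fun S => idfun) (fun S T u a => erefl).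

Lemma psh_mor_comp_nat (F G H : presheaf R) (b : psh_mor G H) (a : psh_mor F G)
    S T (u : fin_mor S T) (s : F S) :
  (b T \o a T) (psh_map F u s) = psh_map H u ((b S \o a S) s).
Proof. by rewrite /= !psh_nat. Qed.

Definition psh_mor_comp (F G H : presheaf R) (b : psh_mor G H) (a : psh_mor F G) :
    psh_mor F H :=
  @PshMor R F H (fun S => b S \o a S) (psh_mor_comp_nat b a).

Lemma sheafification_iso (P F G : presheaf R) (eta : psh_mor P F)
    (theta : psh_mor P G) :
  is_sheafification eta -> is_sheafification theta ->
  exists (a : psh_mor F G) (b : psh_mor G F),
    [/\ forall S s, a S (eta S s) = theta S s,
        forall S, cancel (a S) (b S) & forall S, cancel (b S) (a S)].
Proof.
move=> [Fsh univF] [Gsh univG].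
have [a [aE _]] := univF G theta Gsh; have [b [bE _]] := univG F eta Fsh.
exists a, b; split=> // S s.
  have [c [_ cu]] := univF F eta Fsh.
  rewrite -[LHS]/(psh_mor_comp b a S s) -[RHS]/(psh_mor_id F S s).
  by rewrite [LHS]cu ?[RHS]cu // => T t /=; rewrite aE bE.
have [c [_ cu]] := univG G theta Gsh.
rewrite -[LHS]/(psh_mor_comp a b S s) -[RHS]/(psh_mor_id G S s).
by rewrite [LHS]cu ?[RHS]cu // => T t /=; rewrite bE aE.
Qed.

End Universal.

(** * Purely inseparable elements *)

Lemma pchar_injective (A B : nzRingType) (f : {rmorphism A -> B}) :
  injective f -> [pchar A] =i [pchar B].
Proof.
by move=> finj p; rewrite !inE -(rmorph_nat f) -(inj_eq finj) rmorph0.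
Qed.

Lemma coef_exp_XsubC_pred (K : fieldType) (c : K) d :
  (('X - c%:P) ^+ d.+1)`_d = - c *+ d.+1.
Proof.
elim: d => [|d IHd]; first by rewrite expr1 coefB coefX coefC sub0r.
have lead : (('X - c%:P) ^+ d.+1)`_d.+1 = 1.
  have /monicP := monic_exp d.+1 (monicXsubC c).
  by rewrite lead_coefE size_exp_XsubC.
rewrite exprS mulrBl coefB coefXM coefCM /= IHd lead mulr1.
by rewrite [in RHS]mulrSr.
Qed.

Lemma part_pchar_neq0 (K : fieldType) d : (0 < d)%N -> (d`_[pchar K]^')%:R != 0 :> K.
Proof.
move=> d0; apply/negP => e.
have [p pK] := natf0_pchar (part_gt0 _ _) e.
move: e; rewrite -(dvdn_pcharf pK) => pd.
have := part_pnat [pchar K]^' d => /pnatPpi -/(_ p).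
rewrite mem_primes (pcharf_prime pK) part_gt0 pd /= inE /= pK.
by move/(_ isT).
Qed.

(* Write d = n d' with n the largest power of the characteristic exponent that
   divides d: then (X - c)^d = (X^n - c^n)^d', whose coefficient in degree
   d - n is - d' c^n. *)
Lemma coef_exp_XsubC_part (K : fieldType) (c : K) d :
  (0 < d)%N ->
  (('X - c%:P) ^+ d)`_(d`_[pchar K] * (d`_[pchar K]^').-1)%N =
    - c ^+ (d`_[pchar K])%N * (d`_[pchar K]^')%:R.
Proof.
move=> d0; set n := (d`_[pchar K])%N; set d' := (d`_[pchar K]^')%N.
have n0 : (0 < n)%N by apply: part_gt0.
have pn : [pchar {poly K}].-nat n.
  by rewrite (eq_pnat _ (pchar_poly K)) part_pnat.
have d'0 : (0 < d')%N by apply: part_gt0.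
rewrite -{1}(partnC [pchar K] d0) -/n -/d' exprM exprDn_pchar // exprNn_pchar //.
rewrite -polyC_exp.
have -> : 'X^n - (c ^+ n)%:P = ('X - (c ^+ n)%:P) \Po 'X^n.
  by rewrite comp_polyB comp_polyX comp_polyC.
rewrite -rmorphXn /= coef_comp_poly_Xn // dvdn_mulr // mulKn //.
by rewrite -{1}(prednK d'0) coef_exp_XsubC_pred prednK // mulNrn mulNr mulr_natr.
Qed.

Section PerfectClosureRoot.
Variable K : fieldType.
Implicit Types (n : PerfectClosure.level K) (a : K).

Lemma perfect_piX n a j :
  (\pi_(PerfectClosure.type K) (n, a) : perfect_closure K)%qT ^+ j.+1 =
  (\pi_(PerfectClosure.type K) (n, a ^+ j.+1))%qT.
Proof.
elim: j => [|j IHj]; first by rewrite !expr1.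
rewrite exprS IHj -[LHS]PerfectClosure.pi_mul.
apply: PerfectClosure.pi_eq => /=.
by rewrite -exprMn -exprS [RHS]exprM.
Qed.

Lemma perfect_root n a : exists y : perfect_closure K,
  y ^+ val n = PerfectClosure.embed a.
Proof.
exists (\pi_(PerfectClosure.type K) (n, a))%qT.
have : (0 < val n)%N by case/andP: (valP n).
case E : (val n) => [|j] // _; rewrite perfect_piX.
have -> : PerfectClosure.embed a =
    (\pi_(PerfectClosure.type K) (PerfectClosure.level1 K, a))%qT.
  by rewrite piE.
by apply: PerfectClosure.pi_eq => /=; rewrite expr1 E.
Qed.

End PerfectClosureRoot.

Section RadicalRoot.
Variables (R : idomainType) (n : nat) (a b : R).
Hypothesis pn : [pchar R].-nat n.
Hypothesis b0 : b != 0.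

(** If y^n = a/b, additivity of the n-th power gives P(y)^n as the sum of the P_i^n (a/b)^i; the
    factor b^(size P) clears the denominators. *)
Definition root_relation (P : {poly R}) : R :=
  \sum_(i < size P) P`_i ^+ n * a ^+ i * b ^+ (size P - i).

(* The vanishing of P at an n-th root of a / b does not depend on the
   overfield containing it. *)
Lemma root_relationP (K : fieldType) (f : {rmorphism R -> K}) y P :
  injective f -> f b * y ^+ n = f a ->
  (map_poly f P).[y] = 0 <-> root_relation P = 0.
Proof.
move=> finj fy.
have pnK : [pchar K].-nat n by rewrite -(eq_pnat _ (pchar_injective finj)).
have n0 : (0 < n)%N by case/andP: pn.
have fb0 : f b != 0 by rewrite -(rmorph0 f) (inj_eq finj).
have powE : f (root_relation P) = f b ^+ size P * (map_poly f P).[y] ^+ n.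
  rewrite (@horner_coef_wide _ (size P)) ?size_poly //.
  rewrite (big_morph (fun x => x ^+ n) (id1 := 0) (op1 := +%R)); last first.
  - by rewrite expr0n eqn0Ngt n0.
  - by move=> u v; rewrite exprDn_pchar.
  rewrite mulr_sumr rmorph_sum; apply: eq_bigr => i _.
  rewrite !rmorphM !rmorphXn coef_map exprMn -fy exprMn exprAC.
  have -> : f b ^+ size P = f b ^+ i * f b ^+ (size P - i).
    by rewrite -exprD subnKC // ltnW.
  by ring.
split=> [P0|P0].
  by apply: finj; rewrite powE P0 expr0n eqn0Ngt n0 mulr0 rmorph0.
move/eqP: powE; rewrite P0 rmorph0 eq_sym mulf_eq0 !expf_eq0 (negPf fb0) andbF.
by move=> /andP[_ /eqP].
Qed.

End RadicalRoot.

Section PurelyInseparable.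
Variables (R : idomainType) (T : comNzRingType) (s : {rmorphism R -> T}).
Variables (e : {rmorphism {poly R} -> T}).
Hypothesis es : forall y, exists P, e P = y.
Hypothesis eC : forall r, e r%:P = s r.
Hypothesis sf : finite_hom s.
Variables (K : fieldType) (j : {rmorphism T -> K}).
Hypothesis jinj : injective j.
Hypothesis sinj : injective s.
Variables (W : comPzRingType) (v w : {rmorphism T -> W}).
Hypothesis univ : forall (C : comPzRingType) (a b : {rmorphism T -> C}),
  (forall r, a (s r) = b (s r)) ->
  exists c : {rmorphism W -> C}, (forall x, c (v x) = a x) /\ (forall y, c (w y) = b y).
Hypothesis vw : nilpotent (v (e 'X) - w (e 'X)).

Let f : {rmorphism R -> K} := j \o s.

Lemma eval_generator (A : comNzRingType) (g : {rmorphism T -> A}) P :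
  g (e P) = (map_poly (g \o s) P).[g (e 'X)].
Proof.
elim/poly_ind: P => [|P c IHP]; first by rewrite !rmorph0 horner0.
rewrite !rmorphD !rmorphM IHP eC /= map_polyX map_polyC /=.
by rewrite !hornerE.
Qed.

(** This [m] has least size among the nonzero relations of the generator. Pseudo-division stays over
    R at the price of a factor [c], a power of the leading coefficient, and minimality kills the
    remainder. *)
Lemma minimal_relation : exists m : {poly R},
  [/\ m != 0, e m = 0
    & forall P, e P = 0 -> exists2 c, c != 0 & exists Q, c *: P = Q * m].
Proof.
pose rel k := `[< exists P : {poly R}, [/\ P != 0, e P = 0 & size P = k] >].
have [p pm p0] := finite_hom_integral (e 'X) sf.
have ex_rel : exists k, rel k.
  exists (size p); apply/asboolP; exists p; split=> //; first exact: monic_neq0.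
  have := eval_generator idfun p; rewrite /= => ->.
  by rewrite -[RHS]p0; congr (_.[_]); apply: eq_map_poly.
case: (ex_minnP ex_rel) => k /asboolP[m [m0 em szm]] kmin.
exists m; split=> // P eP; exists (lead_coef m ^+ scalp P m).
  by rewrite expf_neq0 // lead_coef_eq0.
exists (P %/ m); rewrite Pdiv.Idomain.divp_eq.
have [->|r0] := eqVneq (P %% m) 0; first by rewrite addr0.
have /kmin : rel (size (P %% m)).
  apply/asboolP; exists (P %% m); split=> //.
  have := congr1 e (Pdiv.Idomain.divp_eq P m).
  by rewrite rmorphD rmorphM em mulr0 add0r -mul_polyC rmorphM eP mulr0.
by rewrite leqNgt -szm ltn_modpN0.
Qed.

Lemma purely_inseparable : exists (n : nat) (a b : R),
  [/\ [pchar R].-nat n, b != 0 & f b * j (e 'X) ^+ n = f a].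
Proof.
set y := j (e 'X).
have finj : injective f by move=> r r' /jinj /sinj.
have [m [m0 em mP]] := minimal_relation.
set M := map_poly f m.
have M0 : M != 0 by rewrite map_poly_eq0_id0 // -(rmorph0 f) (inj_eq finj) lead_coef_eq0.
have My : M.[y] = 0 by rewrite -[LHS]eval_generator em rmorph0.
(* The ring K[X]/(M) receives T in two ways over R: through the constants K, and by sending the
   generator to X. The map from [W] that they induce makes X - y nilpotent modulo [M], so [M]
   divides a power of X - y. *)
have [||A [pr [_ pr0]]] := @quotient_ring {poly K} (fun Q => M %| Q).
- split=> [|P Q|P Q] /=; [exact: dvdp0 | exact: dvdp_add | exact: dvdp_mull].
- rewrite /= => /dvdpP[Q /(congr1 (horner^~ y))].
  by rewrite hornerM My mulr0 hornerC => /eqP; rewrite oner_eq0.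
have [|g gE] := @factor_rmorphism _ _ _ e (pr \o map_poly f) es.
  move=> P /mP[c c0 [Q cP]]; apply/pr0.
  (* The factor [c] left by pseudo-division is invertible in K, so divisibility by [M] is not
     affected by it. *)
  have fc0 : f c != 0 by rewrite -(rmorph0 f) (inj_eq finj).
  rewrite -(dvdpZr _ _ fc0) /=.
  have -> : f c *: map_poly f P = map_poly f Q * M.
    by rewrite -rmorphM -cP [RHS]map_polyZ.
  exact: dvdp_mull.
have [r|c [cv cw]] := @univ A (pr \o (polyC \o j)) g.
  by rewrite -eC gE /= eC map_polyC.
have [N] := nilpotent_rmorph c (nilpotentBC vw).
rewrite rmorphB cv cw gE /= map_polyX -rmorphB -rmorphXn => /pr0.
case/dvdp_exp_XsubCP=> k _ /eqpP[[c1 c2] /= /andP[c10 c20] cM].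
have k0 : (0 < k)%N.
  case: k cM => // /(congr1 (horner^~ y)); rewrite expr0 !hornerZ My mulr0 hornerC.
  by rewrite mulr1 => /esym/eqP; rewrite (negPf c20).
have coefM i : c1 * f m`_i = c2 * (('X - y%:P) ^+ k)`_i.
  by have := congr1 (fun P : {poly K} => P`_i) cM; rewrite !coefZ coef_map.
set n := (k`_[pchar K])%N; set d := (k`_[pchar K]^')%N.
have lead : c1 * f m`_k = c2.
  rewrite coefM; have /monicP := monic_exp k (monicXsubC y).
  by rewrite lead_coefE size_exp_XsubC => ->; rewrite mulr1.
(* With k = nd, these come from comparing the coefficient of (X - y)^k in degree n(d - 1), namely -
   d y^n, with its leading coefficient 1, both scaled as in [m]. *)
exists n, (- m`_(n * d.-1)%N), (m`_k * d%:R); split.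
- by rewrite (eq_pnat _ (pchar_injective finj)) part_pnat.
- rewrite mulf_eq0 negb_or -[d%:R == 0](inj_eq finj) rmorph_nat rmorph0.
  rewrite part_pchar_neq0 // andbT; apply: contraNneq c20 => mk0.
  by rewrite -lead mk0 rmorph0 mulr0.
apply: (mulfI c10); rewrite !rmorphN mulrN -[j (s m`_(n * d.-1)%N)]/(f _) coefM.
rewrite coef_exp_XsubC_part // -/n -/d -lead /f /= !rmorphM !rmorph_nat.
by ring.
Qed.

End PurelyInseparable.

(** * Global sections over a domain *)

Section GlobalSections.
Variable R : idomainType.
Local Notation B := (fin_base R).
Local Notation L := (perfect_closure {fraction R}).
Local Notation phi := (to_perfect_closure R).

Lemma to_perfect_closure_inj : injective phi.
Proof. by move=> r r' /fmorph_inj/eqP; rewrite tofrac_eq => /eqP. Qed.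

Lemma finite_cover_domain (T : comNzRingType) (u : {rmorphism R -> T}) :
  finite_hom u -> injective u -> finite_cover u.
Proof.
move=> uf uinj; apply: finite_cover_inj => // r.
by rewrite -(rmorph0 u) => /uinj ->; apply: nilpotent0.
Qed.

(** A prime of the cover over the zero ideal of R exists by surjectivity. The quotient by it is a
    domain into which R still injects, hence again a cover, and it embeds into the residue field. *)
Lemma domain_presection (x : presection B) : exists2 y : presection B,
  coincide x y & exists (K : fieldType) (g : {rmorphism ps_obj y -> K}),
    injective g /\ injective (ps_mor y).
Proof.
have [|||p pP] := @prime_ideal_of R (fun r => r = 0).
- by split=> [//|r r' -> ->|r r' ->]; rewrite ?addr0 ?mulr0.
- by apply/eqP/oner_neq0.
- by move=> r r' /eqP; rewrite mulf_eq0 => /orP[]/eqP ->; [left | right].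
have [q qP] := (ps_cover x).2 p; have [K [f fP]] := residue_field q.
have [||Q [pi [pis pi0]]] := @quotient_ring (ps_obj x) (fun z => f z = 0).
- split=> [|y z|y z] /=; first by rewrite rmorph0.
    by rewrite rmorphD => -> ->; rewrite addr0.
  by rewrite rmorphM => ->; rewrite mulr0.
- by rewrite rmorph1; apply/eqP/oner_neq0.
have [g gE] := @factor_rmorphism _ _ _ pi f pis (fun z => (pi0 z).1).
have ginj : injective g.
  move=> y z; have [{}y <-] := pis y; have [{}z <-] := pis z; rewrite !gE => yz.
  apply/eqP; rewrite -subr_eq0 -rmorphB; apply/eqP/pi0.
  by rewrite rmorphB yz subrr.
have uinj : injective (pi \o ps_mor x).
  apply: rmorphism_inj => r /= /pi0/eqP; rewrite -fP -qP => /pP //.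
have uf : finite_hom (pi \o ps_mor x).
  by apply: (finite_hom_comp _ (ps_cover x).1 (finite_hom_surj pis)).
have uc : finite_cover (pi \o ps_mor x) by apply: finite_cover_domain.
have strc : finite_cover (pi \o fin_str (ps_obj x)).
  by apply: finite_cover_ext uc => r; rewrite /= -(fin_morE (ps_mor x)).
pose h : fin_mor (ps_obj x) (FinObj strc) :=
  @FinMor R _ (FinObj strc) pi (fun=> erefl) (finite_hom_surj pis).
have hc : finite_cover (fin_comp h (ps_mor x)) by exact: uc.
by exists (push_presection hc); [exact: coincide_push | exists K, g].
Qed.

Lemma embedded_presection (x : presection B) : exists2 y : presection B,
  coincide x y & exists tau : {rmorphism ps_obj y -> L},
    injective tau /\ forall r : R, tau (ps_mor y r) = phi r.
Proof.
have [x' xx' [K [g [ginj uinj]]]] := domain_presection x.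
have [T [s [e [sc eC es e0]]]] := monogenic (ps_val x') (ps_cover x').
have [em ex'] := monogenic_coincide sc eC es e0.
pose y := Presection sc em.
exists y; first exact: coincide_trans xx' (coincide_sym ex').
pose t := ps_val x'; pose f : {rmorphism R -> K} := g \o ps_mor x'.
have finj : injective f by move=> r r' /ginj /uinj.
have [|j jE] := @factor_rmorphism _ _ _ e (g \o eval_at (ps_mor x') t) es.
  by move=> P /e0 P0; rewrite /= /horner_eval P0 rmorph0.
have jinj : injective j.
  apply: rmorphism_inj => z; have [P <-] := es z; rewrite jE /= => eP0; apply/e0.
  by apply: ginj; rewrite rmorph0.
have jX : j (e 'X) = g t by rewrite jE /= /horner_eval map_polyX hornerX.
have js r : j (s r) = f r.
  by rewrite -eC jE /= /horner_eval map_polyC hornerC.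
have sinj : injective s by move=> r r' /(congr1 j); rewrite !js => /finj.
have [W [v [w [vc vw univ]]]] := fin_pushout s sc.
have nil : nilpotent (v (e 'X) - w (e 'X)) by apply: (em) => r; apply: vw.
have [n [a [b [pn b0 jn]]]] :=
  @purely_inseparable R T s e es eC sc.1 K j jinj sinj W v w univ nil.
have pn' : [pchar {fraction R}].-nat n.
  rewrite -(eq_pnat _ (pchar_injective (f := @FracField.tofrac R) _)) //.
  by move=> r r' /eqP; rewrite tofrac_eq => /eqP.
have [z zn] := @perfect_root {fraction R} (exist _ n pn')
  (FracField.tofrac a / FracField.tofrac b).
have phib : phi b * z ^+ n = phi a.
  rewrite [z ^+ n]zn -[phi b]/(PerfectClosure.embed (FracField.tofrac b)) -rmorphM mulrCA.
  by rewrite mulfV ?mulr1 // tofrac_eq0.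
(* Evaluation at t in K and at the root z in Q(R)^oo have the same kernel in R[X], since both are
   described by [root_relation]. This gives at once a map from R[t] to Q(R)^oo and its
   injectivity. *)
have ker P : e P = 0 <-> (map_poly phi P).[z] = 0.
  rewrite (root_relationP pn b0 P to_perfect_closure_inj phib).
  rewrite -(@root_relationP R n a b pn b0 K f (g t) P finj); last first.
    by rewrite -jX -js jn /= js.
  have -> : map_poly f P = map_poly g (map_poly (ps_mor x') P).
    exact: map_poly_comp.
  rewrite e0 horner_map.
  by split=> [->|P0]; [rewrite rmorph0 | apply: ginj; rewrite rmorph0].
have [|tau tauE] := @factor_rmorphism _ _ _ e (eval_at phi z) es.
  by move=> P /ker.
exists tau; split=> [|r].
  apply: rmorphism_inj => q; have [P <-] := es q; rewrite tauE => P0.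
  exact/ker.
by rewrite -[ps_mor y r]eC tauE /= /horner_eval map_polyC hornerC.
Qed.

(** Injectivity of [tau] is left out so that the pushout of two representatives, which maps to L but
    need not embed, can compare their values. *)
Definition section_value (f : fin_section B) (y : L) : Prop :=
  exists2 x : presection B, f = fin_class x &
    exists2 tau : {rmorphism ps_obj x -> L},
      forall r : R, tau (ps_mor x r) = phi r & tau (ps_val x) = y.

Lemma common_value f g y y' : section_value f y -> section_value g y' ->
  exists (T : fin_obj R) (u : fin_mor B T) (uc : finite_cover u) (a b : T)
    (am : weakly_matching u a) (bm : weakly_matching u b)
    (tau : {rmorphism T -> L}),
    [/\ f = fin_class (Presection uc am), g = fin_class (Presection uc bm),
        forall r : R, tau (u r) = phi r, tau a = y & tau b = y'].
Proof.
move=> [x -> [t tE <-]] [x' -> [t' t'E <-]].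
have [W [v [w [vc vw univ]]]] := fin_pushout (ps_mor x) (ps_cover x').
have [|tau [tv tw]] := univ L t t'; first by move=> r; rewrite tE t'E.
have uc := fin_comp_cover (ps_cover x) vc.
have xm := push_matching (f := v) (x := x).
have x'm : weakly_matching (fin_comp v (ps_mor x)) (w (ps_val x')).
  move=> V g' h' gh; apply: (ps_matching (g := fin_comp g' w) (h := fin_comp h' w)).
  by move=> r /=; rewrite -vw; apply: gh.
exists W, (fin_comp v (ps_mor x)), uc, _, _, xm, x'm, tau; split=> //.
- exact/fin_classP/coincide_push.
- apply/fin_classP; apply: (@coincideI _ _ _ (Presection uc x'm) W w (fin_id W)).
  + by apply: finite_cover_ext uc => r /=; rewrite vw.
  + by move=> r /=; rewrite vw.
  + by rewrite /= subrr; apply: nilpotent0.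
- by move=> r /=; rewrite tv tE.
Qed.

(** On a common cover the two representatives differ by a nilpotent, and the field L has no nonzero
    nilpotent. *)
Lemma section_value_inj f y y' : section_value f y -> section_value f y' -> y = y'.
Proof.
move=> fy fy'.
have [T [u [uc [a [b [am [bm [tau [-> ab _ <- <-]]]]]]]]] := common_value fy fy'.
move/fin_classP/(_ T (fin_id T) (fin_id T) (fun=> erefl)): ab => /= ab.
by apply/eqP; rewrite -subr_eq0 -rmorphB; apply/eqP/nilpotent_eq0/nilpotent_rmorph.
Qed.

Lemma global_value : exists Phi : {rmorphism fin_section B -> L},
  forall f, section_value f (Phi f).
Proof.
have ex_val f : exists y, section_value f y.
  have [x ->] := fin_class_surj f; have [y xy [tau [_ tauE]]] := embedded_presection x.
  by exists (tau (ps_val y)), y; [exact/fin_classP | exists tau].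
have [F FP] := choice ex_val.
have FE f y : section_value f y -> F f = y by apply: section_value_inj.
have [T0 u0 uc0 a0 b0 am0 bm0 f g||Phi PhiE] := @fin_section_rmorphism _ B _ F.
- have [T [u [uc [a [b [am [bm [tau [-> -> tu ta tb]]]]]]]]] :=
    common_value (FP f) (FP g).
  rewrite fin_classD fin_classM; split; apply: FE.
    by eexists; first reflexivity; exists tau => //=; rewrite rmorphD ta tb.
  by eexists; first reflexivity; exists tau => //=; rewrite rmorphM ta tb.
- apply: FE; rewrite (fin_class1 (fin_id_cover B)).
  by eexists; first reflexivity; exists phi; rewrite //= rmorph1.
by exists Phi => f; rewrite PhiE.
Qed.

Lemma Fin_global_sections : exists Phi : {rmorphism fin_section B -> L},
  [/\ injective Phi, forall r : R, Phi (sec_eta B r) = phi r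
    & forall y : L, (exists f, Phi f = y) <-> compatible_normalization y].
Proof.
have [Phi PhiP] := global_value; exists Phi.
have PhiE f y : section_value f y -> Phi f = y by apply: section_value_inj.
have value (x : presection B) (tau : {rmorphism ps_obj x -> L}) :
    (forall r : R, tau (ps_mor x r) = phi r) -> Phi (fin_class x) = tau (ps_val x).
  by move=> tauE; apply: PhiE; exists x => //; exists tau.
have embed f : exists2 x : presection B, f = fin_class x &
    exists tau : {rmorphism ps_obj x -> L},
      injective tau /\ forall r : R, tau (ps_mor x r) = phi r.
  have [x ->] := fin_class_surj f; have [y xy tauP] := embedded_presection x.
  by exists y => //; apply/fin_classP.
split=> [|r|y].
- apply: rmorphism_inj => f; have [x -> [tau [tinj tE]]] := embed f.
  rewrite (value x tau tE) => /eqP; rewrite -(rmorph0 tau) (inj_eq tinj) => /eqP x0.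
  rewrite -(rmorph0 (sec_eta B)) (sec_etaE (ps_cover x)).
  by apply/fin_classP => V g h gh /=; rewrite x0 !rmorph0 subrr; apply: nilpotent0.
- rewrite (sec_etaE (fin_id_cover B)).
  exact: (value (Presection (fin_id_cover B) (matching_str (u := fin_id B) r)) phi).
split=> [[f <-]|[T [alpha [tau [t [tinj tE af <- [P [i1 [i2 [ten nil]]]]]]]]]].
  have [x -> [tau [tinj tE]]] := embed f; rewrite (value x tau tE).
  exists (ps_obj x), (ps_mor x), tau, (ps_val x); split=> //; first exact: (ps_cover x).1.
  have [P [i1 [i2 [ten _]]]] := tensor_product (ps_mor x) (ps_mor x).
  exists P, i1, i2; split; first exact: ten.
  (* The tensor square [P] is not given as an object of the site. Weak matching yields nilpotency in
     the pushout [W], which is then carried to [P]. *)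
  have [W [v [w [vc vw univ]]]] := fin_pushout (ps_mor x) (ps_cover x).
  have [c [cv cw]] := univ P i1 i2 ten.1.
  rewrite -cv -cw -rmorphB; apply: nilpotent_rmorph; apply: (ps_matching (p := x)).
  by move=> r; apply: vw.
(* Since R embeds in L, it embeds in [T]; a finite injective map is a cover, so [T] belongs to the
   site, and any two maps out of [T] that agree on R factor through the tensor square. *)
have ainj : injective alpha.
  by move=> r r' /(congr1 tau); rewrite !tE; apply: to_perfect_closure_inj.
have ac : finite_cover alpha by apply: finite_cover_domain.
pose u : fin_mor B (FinObj ac) := @FinMor R B (FinObj ac) alpha (fun=> erefl) af.
have tm : @weakly_matching R B (FinObj ac) u t.
  move=> V g h gh; have [c [c1 c2]] := tensor_rmorphism (a := g) (b := h) ten gh.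
  by rewrite -c1 -c2 -rmorphB; apply: nilpotent_rmorph.
pose x := @Presection R B (FinObj ac) u ac t tm.
by exists (fin_class x); apply: (value x tau).
Qed.

End GlobalSections.

Theorem proposition5p2p3 (R : idomainType) (HR : noetherian R) :
  (exists (Ofin : presheaf R) (eta : psh_mor (structure_presheaf R) Ofin),
     is_sheafification eta) /\
  forall (Ofin : presheaf R) (eta : psh_mor (structure_presheaf R) Ofin),
    is_sheafification eta ->
    exists Phi : {rmorphism Ofin (fin_base R) -> perfect_closure {fraction R}},
      [/\ injective Phi,
          (forall r : R, Phi (eta (fin_base R) r) = to_perfect_closure R r)
        & forall y : perfect_closure {fraction R},
            (exists s, Phi s = y) <-> compatible_normalization y].
Proof.
split=> [|Ofin eta etaP].
  by exists (Fin R), (Fin_eta R); apply: Fin_sheafification.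
have [a [b [aE aK bK]]] := sheafification_iso etaP (Fin_sheafification R).
have [Phi [Pinj Peta Pim]] := Fin_global_sections R.
exists (Phi \o a (fin_base R)); split=> [|r|y].
- by move=> s s' /Pinj; apply: (can_inj (aK _)).
- by rewrite /= aE; apply: Peta.
rewrite -Pim; split=> [[s <-]|[f <-]]; first by exists (a (fin_base R) s).
by exists (b (fin_base R) f); rewrite /= bK.
Qed.
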